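(* Let $X\subset\mathbb{R}^p$, $Y\subset\mathbb{R}^q$, $Z\subset\mathbb{R}^r$ and $F:\mathbb{R}^p\times\mathbb{R}^q\times\mathbb{R}^r\to\mathbb{R}$, and let $\{(x^k,y^k,z^k)\}_{k\in\mathbb{N}}$ be a sequence generated by the Proximal Block Implicit-Explicit Algorithm (described in the context) for some initial point $(x^0,y^0,z^0)\in X\times Y\times Z$. Suppose that: (i) $X$, $Y$, $Z$ are nonempty and closed. (ii) $F$ is differentiable on $X\times Y\times Z$ and $\inf F>-\infty$. Moreover, for all fixed $y\in\mathbb{R}^q$, $z\in\mathbb{R}^r$ the function $x\mapsto F(x,y,z)$ is continuously differentiable and its gradient $\nabla_xF(\cdot,y,z)$ is Lipschitz continuous with modulus $L_x(y,z)$; and for all fixed $x\in\mathbb{R}^p$, $z\in\mathbb{R}^r$ the function $y\mapsto F(x,y,z)$ is continuously differentiable and its gradient $\nabla_yF(x,\cdot,z)$ is Lipschitz continuous with modulus $L_y(x,z)$. (iii) $\nabla F$ is Lipschitz continuous on bounded domains in $X\times Y\times Z$, and there exist $\lambda_x^+,\lambda_y^+>0$ such that $\sup\{L_x(y^k,z^k) : k\in\mathbb{N}\}\le\lambda_x^+$ and $\sup\{L_y(x^{k+1},z^k) : k\in\mathbb{N}\}\le\lambda_y^+$. (iv) The iterates $\{(x^k,y^k,z^k)\}_{k\in\mathbb{N}}$ are bounded. (v) The function $\Psi(x,y,z)=F(x,y,z)+\iota_X(x)+\iota_Y(y)+\iota_Z(z)$ is a KL function. Then: (a) The sequence has finite length,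 that is, $$\sum_{k=1}^\infty\|(x^{k+1},y^{k+1},z^{k+1})-(x^k,y^k,z^k)\|<\infty.$$ (b) The sequence converges to a point $(x^*,y^*,z^* )$ satisfying $$0\in\nabla F(x^*,y^*,z^* )+\partial\iota_X(x^* )\times\partial\iota_Y(y^* )\times\partial\iota_Z(z^* ).$$
   Context: For a set $C$, $\iota_C$ is the indicator function: $\iota_C(x)=0$ if $x\in C$, $\iota_C(x)=+\infty$ otherwise. Proximal Block Implicit-Explicit Algorithm. Fix $\eta_x,\eta_y>0$ and put $L_x'(y,z)=\max\{L_x(y,z),\eta_x\}$, $L_y'(x,z)=\max\{L_y(x,z),\eta_y\}$. Choose $\alpha,\beta>1$, $\gamma>0$ and $(x^0,y^0,z^0)\in X\times Y\times Z$. For $k=0,1,\dots$: 1. Set $\alpha^k=\alpha L_x'(y^k,z^k)$ and select $x^{k+1}\in\operatorname{argmin}_{x\in X}\{\langle x-x^k,\nabla_xF(x^k,y^k,z^k)\rangle+\frac{\alpha^k}{2}\|x-x^k\|^2\}$. 2. Set $\beta^k=\beta L_y'(x^{k+1},z^k)$ and select $y^{k+1}\in\operatorname{argmin}_{y\in Y}\{\langle y-y^k,\nabla_yF(x^{k+1},y^k,z^k)\rangle+\frac{\beta^k}{2}\|y-y^k\|^2\}$. 3. Select $z^{k+1}\in\operatorname{argmin}_{z\in Z}\{F(x^{k+1},y^{k+1},z)+\frac{\gamma}{2}\|z-z^k\|^2\}$. Subdifferential. For $f:\mathbb{R}^d\to(-\infty,+\infty]$ proper and lower semicontinuous and $u\in\operatorname{dom}f$,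 the regular (Fréchet) subdifferential $\widehat\partial f(u)$ is the set of $v\in\mathbb{R}^d$ with $\liminf_{w\to u,\,w\ne u}\frac{f(w)-f(u)-\langle v,w-u\rangle}{\|w-u\|}\ge0$, and $\widehat\partial f(u)=\emptyset$ for $u\notin\operatorname{dom}f$. The limiting subdifferential $\partial f(u)$ is the set of $v$ for which there exist $u^k\to u$ with $f(u^k)\to f(u)$ and $v^k\to v$ with $v^k\in\widehat\partial f(u^k)$. $\operatorname{dom}\partial f=\{u:\partial f(u)\neq\emptyset\}$. KL property. For $\eta\in(0,+\infty]$ let $\mathcal{C}_\eta$ be the set of continuous functions $\varphi:[0,\eta)\to\mathbb{R}_+$ with $\varphi(0)=0$, $\varphi$ of class $C^1$ on $(0,\eta)$ and $\varphi'(s)>0$ for all $s\in(0,\eta)$. A proper lower semicontinuous $f$ has the Kurdyka-Łojasiewicz (KL) property at $\bar u\in\operatorname{dom}\partial f$ if there exist $\eta\in(0,+\infty]$, a neighborhood $U$ of $\bar u$ and $\varphi\in\mathcal{C}_\eta$ such that for all $u\in U$ with $f(\bar u)<f(u)<f(\bar u)+\eta$ one has $\varphi'(f(u)-f(\bar u))\,\operatorname{dist}(0,\partial f(u))\ge1$ (with $\operatorname{dist}(0,\emptyset)=+\infty$). $f$ is a KL function if it has the KL property at each point of $\operatorname{dom}\partial f$. *)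

(* Defs.v *)
From HB Require Import structures.
From mathcomp Require Import all_boot all_order all_algebra.
From mathcomp Require Import all_classical all_reals all_analysis.

Set Implicit Arguments.
Unset Strict Implicit.
Unset Printing Implicit Defensive.

Import Order.TTheory GRing.Theory Num.Theory.
Import numFieldNormedType.Exports.

Local Open Scope classical_set_scope.
Local Open Scope ring_scope.

(* The library norm `|u| on 'rV[R]_d is the sup norm.  It is equivalent to
   [enorm], so the library's topology, differentiability and boundedness are
   the Euclidean ones; [enorm] is used wherever the norm itself matters. *)
Definition dot (R : realType) (d : nat) (u v : 'rV[R]_d) : R :=
  \sum_(i < d) u 0 i * v 0 i.

Definition enorm (R : realType) (d : nat) (u : 'rV[R]_d) : R :=
  Num.sqrt (dot u u).

(* dist(u, A), with dist(u, set0) = +oo. *)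
Definition edist (R : realType) (d : nat) (u : 'rV[R]_d) (A : set 'rV[R]_d)
    : \bar R :=
  ereal_inf [set (enorm (u - v))%:E | v in A].

Definition grad (R : realType) (d : nat) (f : 'rV[R]_d -> R) (u : 'rV[R]_d)
    : 'rV[R]_d :=
  \row_(i < d) 'D_(delta_mx 0 i) f u.

Definition cont_diff (R : realType) (d : nat) (f : 'rV[R]_d -> R) : Prop :=
  (forall u, differentiable f u) /\ continuous (grad f).

Definition lipschitz_modulus (R : realType) (d e : nat) (A : set 'rV[R]_d)
    (g : 'rV[R]_d -> 'rV[R]_e) (L : R) : Prop :=
  forall u v, A u -> A v -> enorm (g u - g v) <= L * enorm (u - v).

Definition argmin (R : realType) (T : Type) (A : set T) (g : T -> R) : set T :=
  [set t | A t /\ forall s, A s -> g t <= g s].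

Definition indic_conv (R : realType) (d : nat) (C : set 'rV[R]_d)
    (u : 'rV[R]_d) : \bar R :=
  if u \in C then 0%E else +oo%E.

Section Subdifferential.
Local Open Scope ereal_scope.

Definition edom (R : realType) (d : nat) (f : 'rV[R]_d -> \bar R)
    : set 'rV[R]_d :=
  [set u | f u < +oo].

Definition proper (R : realType) (d : nat) (f : 'rV[R]_d -> \bar R) : Prop :=
  edom f !=set0 /\ forall u, -oo < f u.

(* [u^'] is the filter of punctured neighbourhoods of u. *)
Definition frechet_subdiff (R : realType) (d : nat) (f : 'rV[R]_d -> \bar R)
    (u : 'rV[R]_d) : set 'rV[R]_d :=
  [set v | edom f u /\
    0 <= limf_einf (fun w => (f w - f u - (dot v (w - u))%:E)
                             * ((enorm (w - u))^-1)%:E) u^'].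

Definition limiting_subdiff (R : realType) (d : nat) (f : 'rV[R]_d -> \bar R)
    (u : 'rV[R]_d) : set 'rV[R]_d :=
  [set v | edom f u /\
    exists (us vs : nat -> 'rV[R]_d),
      [/\ us @ \oo --> u, f \o us @ \oo --> f u, vs @ \oo --> v &
          forall k, frechet_subdiff f (us k) (vs k)]].

Definition dom_subdiff (R : realType) (d : nat) (f : 'rV[R]_d -> \bar R)
    : set 'rV[R]_d :=
  [set u | limiting_subdiff f u !=set0].

(* The class C_eta; a function on [0, eta) is a total function of which only
   the values on [0, eta) matter. *)
Definition desingularizing (R : realType) (eta : \bar R) (phi : R -> R)
    : Prop :=
  [/\ {within [set s : R | (0 <= s)%R /\ s%:E < eta], continuous phi},
      forall s : R, (0 <= s)%R -> s%:E < eta -> (0 <= phi s)%R,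
      phi 0%R = 0%R &
      forall s : R, (0 < s)%R -> s%:E < eta ->
        [/\ derivable phi s 1%R, {for s, continuous phi^`()%classic} &
            (0 < phi^`()%classic s)%R]].

Definition KL_at (R : realType) (d : nat) (f : 'rV[R]_d -> \bar R)
    (ub : 'rV[R]_d) : Prop :=
  exists (eta : \bar R) (U : set 'rV[R]_d) (phi : R -> R),
    [/\ 0 < eta, nbhs ub U, desingularizing eta phi &
        forall u, U u -> f ub < f u -> f u < f ub + eta ->
          1 <= (phi^`()%classic (fine (f u - f ub)))%:E
               * edist 0%R (limiting_subdiff f u)].

Definition KL_function (R : realType) (d : nat) (f : 'rV[R]_d -> \bar R)
    : Prop :=
  [/\ proper f, lower_semicontinuous f &
      forall u, dom_subdiff f u -> KL_at f u].

End Subdifferential.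

(* R^p x R^q x R^r is identified with R^(p + q + r). *)
Definition triple (R : realType) (p q r : nat)
    (x : 'rV[R]_p) (y : 'rV[R]_q) (z : 'rV[R]_r) : 'rV[R]_(p + q + r) :=
  row_mx (row_mx x y) z.

Definition xpart (R : realType) (p q r : nat) (u : 'rV[R]_(p + q + r))
    : 'rV[R]_p := lsubmx (lsubmx u).
Definition ypart (R : realType) (p q r : nat) (u : 'rV[R]_(p + q + r))
    : 'rV[R]_q := rsubmx (lsubmx u).
Definition zpart (R : realType) (p q r : nat) (u : 'rV[R]_(p + q + r))
    : 'rV[R]_r := rsubmx u.

Definition prod3 (R : realType) (p q r : nat)
    (X : set 'rV[R]_p) (Y : set 'rV[R]_q) (Z : set 'rV[R]_r)
    : set 'rV[R]_(p + q + r) :=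
  [set u | [/\ X (xpart u), Y (ypart u) & Z (zpart u)]].

Definition gradx (R : realType) (p q r : nat) (F : 'rV[R]_(p + q + r) -> R)
    (x : 'rV[R]_p) (y : 'rV[R]_q) (z : 'rV[R]_r) : 'rV[R]_p :=
  grad (fun x' => F (triple x' y z)) x.

Definition grady (R : realType) (p q r : nat) (F : 'rV[R]_(p + q + r) -> R)
    (x : 'rV[R]_p) (y : 'rV[R]_q) (z : 'rV[R]_r) : 'rV[R]_q :=
  grad (fun y' => F (triple x y' z)) y.

Definition Psi (R : realType) (p q r : nat) (F : 'rV[R]_(p + q + r) -> R)
    (X : set 'rV[R]_p) (Y : set 'rV[R]_q) (Z : set 'rV[R]_r)
    (u : 'rV[R]_(p + q + r)) : \bar R :=
  ((F u)%:E + indic_conv X (xpart u) + indic_conv Y (ypart u)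
   + indic_conv Z (zpart u))%E.

(* The sequence (x k, y k, z k) is a run of the Proximal Block
   Implicit-Explicit Algorithm. *)
Definition block_imex (R : realType) (p q r : nat)
    (F : 'rV[R]_(p + q + r) -> R)
    (X : set 'rV[R]_p) (Y : set 'rV[R]_q) (Z : set 'rV[R]_r)
    (Lx : 'rV[R]_q -> 'rV[R]_r -> R) (Ly : 'rV[R]_p -> 'rV[R]_r -> R)
    (etax etay alpha beta gamma : R)
    (x : nat -> 'rV[R]_p) (y : nat -> 'rV[R]_q) (z : nat -> 'rV[R]_r)
    : Prop :=
  [/\ X (x 0%N), Y (y 0%N), Z (z 0%N) &
  forall k : nat,
    let alphak := alpha * Num.max (Lx (y k) (z k)) etax in
    let betak := beta * Num.max (Ly (x k.+1) (z k)) etay in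
    [/\ argmin X (fun x' => dot (x' - x k) (gradx F (x k) (y k) (z k))
                            + alphak / 2 * enorm (x' - x k) ^+ 2) (x k.+1),
        argmin Y (fun y' => dot (y' - y k) (grady F (x k.+1) (y k) (z k))
                            + betak / 2 * enorm (y' - y k) ^+ 2) (y k.+1) &
        argmin Z (fun z' => F (triple (x k.+1) (y k.+1) z')
                            + gamma / 2 * enorm (z' - z k) ^+ 2) (z k.+1)]].

(* Main.v *)
(* The desingularizing function phi is not assumed concave, so the usual
   telescoping, which applies the tangent inequality to phi at F u_k - F*, is
   not available.  Instead, let W = X x Y x Z and let D be the length of the
   step from u_k to u_(k+1).  Testing the three argmins against the blocks of
   an arbitrary w in W, and using the descent lemma for the first two, gives
     F u_(k+1) + c D^2 <= F w + H w + A |w - u_k|^2,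
   where H u_k = 0 and, the gradient of F being Lipschitz on bounded parts of
   W, H has slope O(D) along W at distance at most D from u_k.  Minimize
     phi (F w - F* ) + |w - u_k| / 16 + (theta / D) max (H w) 0
   over the w in W with |w - u_k| <= D and F u_(k+1) <= F w <= F u_k.  At a
   minimizer with |w - u_k| < D and F u_(k+1) < F w, phi o F would have a small
   slope along W; projecting w - t grad F w onto W then yields nearby points at
   which grad F + n is small for some normal n, against the KL inequality.  So
   the minimizer has F w = F u_(k+1) or |w - u_k| = D, and comparing with the
   value at u_k gives in both cases
     D <= C (phi (F u_k - F* ) - phi (F u_(k+1) - F* )).
   These bounds telescope and trap the iterates near a cluster point. *)

Require Import Defs.
From HB Require Import structures.
From mathcomp Require Import all_boot all_order all_algebra.
From mathcomp Require Import all_classical all_reals all_analysis.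
From mathcomp Require Import ring lra.

Set Implicit Arguments.
Unset Strict Implicit.
Unset Printing Implicit Defensive.

Import Order.TTheory GRing.Theory Num.Theory.
Import numFieldNormedType.Exports.

Local Open Scope classical_set_scope.
Local Open Scope ring_scope.

(** * Euclidean norm *)

Lemma dotC (R : realType) d (u v : 'rV[R]_d) : dot u v = dot v u.
Proof. by apply: eq_bigr => i _; rewrite mulrC. Qed.

Lemma dotDl (R : realType) d (u v w : 'rV[R]_d) :
  dot (u + v) w = dot u w + dot v w.
Proof. by rewrite -big_split; apply: eq_bigr => i _; rewrite mxE mulrDl. Qed.

Lemma dotZl (R : realType) d (a : R) (u w : 'rV[R]_d) :
  dot (a *: u) w = a * dot u w.
Proof. by rewrite mulr_sumr; apply: eq_bigr => i _; rewrite mxE mulrA. Qed.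

Lemma dotNl (R : realType) d (u w : 'rV[R]_d) : dot (- u) w = - dot u w.
Proof. by rewrite -scaleN1r dotZl mulN1r. Qed.

Lemma dotDr (R : realType) d (u v w : 'rV[R]_d) :
  dot w (u + v) = dot w u + dot w v.
Proof. by rewrite dotC dotDl ![dot _ w]dotC. Qed.

Lemma dotZr (R : realType) d (a : R) (u w : 'rV[R]_d) :
  dot w (a *: u) = a * dot w u.
Proof. by rewrite dotC dotZl dotC. Qed.

Lemma dotNr (R : realType) d (u w : 'rV[R]_d) : dot w (- u) = - dot w u.
Proof. by rewrite dotC dotNl dotC. Qed.

Lemma dot0r (R : realType) d (w : 'rV[R]_d) : dot w 0 = 0.
Proof. by rewrite -(scale0r 0) dotZr mul0r. Qed.

Definition dotE := (dotDl, dotDr, dotZl, dotZr, dotNl, dotNr).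

Lemma dot_ge0 (R : realType) d (u : 'rV[R]_d) : 0 <= dot u u.
Proof. by apply: sumr_ge0 => i _; rewrite -expr2 sqr_ge0. Qed.

Lemma enorm_ge0 (R : realType) d (u : 'rV[R]_d) : 0 <= enorm u.
Proof. exact: sqrtr_ge0. Qed.

Lemma enorm_sqr (R : realType) d (u : 'rV[R]_d) : enorm u ^+ 2 = dot u u.
Proof. by rewrite sqr_sqrtr ?dot_ge0. Qed.

Lemma enorm0 (R : realType) d : enorm (0 : 'rV[R]_d) = 0.
Proof. by rewrite /enorm dot0r sqrtr0. Qed.

Lemma enormZ (R : realType) d (a : R) (u : 'rV[R]_d) :
  enorm (a *: u) = `|a| * enorm u.
Proof.
by rewrite /enorm !dotE mulrA -expr2 sqrtrM ?sqr_ge0// sqrtr_sqr.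
Qed.

Lemma enormN (R : realType) d (u : 'rV[R]_d) : enorm (- u) = enorm u.
Proof. by rewrite -scaleN1r enormZ normrN1 mul1r. Qed.

Lemma enormB (R : realType) d (u v : 'rV[R]_d) : enorm (u - v) = enorm (v - u).
Proof. by rewrite -enormN opprB. Qed.

Lemma normr_le_enorm (R : realType) d (u : 'rV[R]_d) : `|u| <= enorm u.
Proof.
rewrite [leLHS]mx_normrE; apply/bigmax_leP; split=> [|[i j] _ /=].
  exact: enorm_ge0.
rewrite -sqrtr_sqr ler_sqrt ?dot_ge0// ord1 /dot (bigD1 j)//= expr2 lerDl.
by apply: sumr_ge0 => k _; rewrite -expr2 sqr_ge0.
Qed.

Lemma enorm_eq0 (R : realType) d (u : 'rV[R]_d) : enorm u = 0 -> u = 0.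
Proof.
by move=> u0; apply/eqP; rewrite -normr_le0 -u0 normr_le_enorm.
Qed.

(** Cauchy-Schwarz, from expanding the square of [enorm v *: u - enorm u *: v]. Zero vectors are
    split off so that the positive factor [enorm u * enorm v] can be cancelled. *)
Lemma dot_le_enorm (R : realType) d (u v : 'rV[R]_d) :
  dot u v <= enorm u * enorm v.
Proof.
have [/enorm_eq0->|u0] := eqVneq (enorm u) 0.
  by rewrite dotC dot0r enorm0 mul0r.
have [/enorm_eq0->|v0] := eqVneq (enorm v) 0.
  by rewrite dot0r enorm0 mulr0.
have uv_gt0 : 0 < enorm u * enorm v.
  by rewrite mulr_gt0// lt0r ?u0 ?v0 enorm_ge0.
rewrite -subr_ge0 -(pmulr_rge0 _ uv_gt0).
have := dot_ge0 (enorm v *: u - enorm u *: v).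
rewrite !dotE -!enorm_sqr [dot v u]dotC; nra.
Qed.

Lemma normr_dot_le (R : realType) d (u v : 'rV[R]_d) :
  `|dot u v| <= enorm u * enorm v.
Proof.
by rewrite ler_norml dot_le_enorm lerNl -dotNl -(enormN u) dot_le_enorm.
Qed.

Lemma enormD (R : realType) d (u v : 'rV[R]_d) :
  enorm (u + v) <= enorm u + enorm v.
Proof.
have := enorm_ge0 u; have := enorm_ge0 v => v0 u0.
rewrite -(ler_pXn2r (_ : 0 < 2)%N) ?nnegrE ?addr_ge0 ?enorm_ge0//.
rewrite enorm_sqr !dotE -!enorm_sqr [dot v u]dotC.
have := dot_le_enorm u v; nra.
Qed.

Lemma enorm_sqrD (R : realType) d (u v : 'rV[R]_d) :
  enorm (u + v) ^+ 2 = enorm u ^+ 2 + 2 * dot u v + enorm v ^+ 2.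
Proof. by rewrite !enorm_sqr !(dotDl, dotDr) [dot v u]dotC; ring. Qed.

Lemma enorm_le_normr (R : realType) d (u : 'rV[R]_d) :
  enorm u <= d%:R * `|u|.
Proof.
have le_u i : `|u 0 i| <= `|u|.
  rewrite [leRHS]mx_normrE.
  exact: (le_bigmax _ (fun ij => `|u ij.1 ij.2|) (0, i)).
rewrite -(ler_pXn2r (_ : 0 < 2)%N) ?nnegrE ?mulr_ge0 ?enorm_ge0//.
rewrite enorm_sqr exprMn.
apply: (@le_trans _ _ (d%:R * `|u| ^+ 2)).
  rewrite mulr_natl -[X in _ *+ X]card_ord -sumr_const.
  apply: ler_sum => i _; rewrite -expr2 -real_normK ?num_real//.
  by rewrite ler_pXn2r ?nnegrE.
apply: ler_wpM2r; first exact: sqr_ge0.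
by rewrite -natrX ler_nat; case: (d) => // n; rewrite leq_pmulr.
Qed.

(** The two norms bound each other up to the factor [d], so Euclidean balls generate the same
    neighbourhoods. Later estimates reach the topology through this equivalence. *)
Lemma near_enormP (R : realType) d (u : 'rV[R]_d) (P : set 'rV[R]_d) :
  (\forall w \near u, P w) <->
  exists2 e : R, 0 < e & forall w, enorm (w - u) < e -> P w.
Proof.
split=> [/nbhs_ballP[e /= e0 eP]|[e e0 eP]].
  exists e => // w wu; apply: eP; rewrite -ball_normE /ball_ /= distrC.
  exact: le_lt_trans (normr_le_enorm _) wu.
(* [d.+1] rather than [d] keeps the radius positive in dimension 0. *)
apply/nbhs_ballP; exists (e / d.+1%:R) => /=; first by rewrite divr_gt0.
move=> w; rewrite -ball_normE /ball_ /= distrC ltr_pdivlMr// => wu.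
apply: eP; apply: le_lt_trans (enorm_le_normr _) _.
by apply: le_lt_trans wu; rewrite mulrC ler_wpM2l// ler_nat.
Qed.

Lemma cvg_enormP (R : realType) d (us : nat -> 'rV[R]_d) (u : 'rV[R]_d) :
  us @ \oo --> u <->
  forall e : R, 0 < e -> \forall k \near \oo, enorm (us k - u) < e.
Proof.
split=> [uu e e0|H].
  by apply: (uu [set w | enorm (w - u) < e]); apply/near_enormP; exists e.
move=> P /near_enormP[e e0 eP]; have := H _ e0.
by apply: filterS => k; exact: eP.
Qed.

(** * Normals and subgradients *)

Lemma derive_dot (R : realType) d (f : 'rV[R]_d -> R) (u v : 'rV[R]_d) :
  differentiable f u -> 'D_v f u = dot (grad f u) v.
Proof.
move=> df; rewrite deriveE// {1}(row_sum_delta v) linear_sum.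
by apply: eq_bigr => i _; rewrite linearZ /= mxE deriveE// mulrC.
Qed.

Lemma differentiable_near (R : realType) d (f : 'rV[R]_d -> R) (u : 'rV[R]_d) :
  differentiable f u -> forall e : R, 0 < e ->
  \forall w \near u, `|f w - f u - dot (grad f u) (w - u)| <= e * enorm (w - u).
Proof.
move=> df e e0; have /eqaddoP/(_ _ e0)/near_enormP[del del0 H] :=
  diff_locally df.
apply/near_enormP; exists del => // w wu; have := H (w - u).
rewrite subr0 => /(_ wu); rewrite /= !fctE /= subrK -deriveE// derive_dot//.
rewrite opprD addrA => /le_trans; apply.
by rewrite ler_wpM2l ?normr_le_enorm// ltW.
Qed.

Lemma differentiable_continuous_enorm (R : realType) d (f : 'rV[R]_d -> R)
    (u : 'rV[R]_d) : differentiable f u ->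
  forall e : R, 0 < e -> \forall w \near u, `|f w - f u| < e.
Proof.
move=> /differentiable_continuous cf e e0.
by have /cvgrPdist_lt/(_ _ e0) := cf; apply: filterS => w; rewrite distrC.
Qed.

(** The Fréchet normal cone to [W] at [w], with its upper limit unfolded into an epsilon statement;
    a normal also records that [w] lies in [W]. *)
Definition regular_normal (R : realType) d (W : set 'rV[R]_d)
    (w n : 'rV[R]_d) : Prop :=
  W w /\ forall e : R, 0 < e ->
    \forall w' \near w, W w' -> dot n (w' - w) <= e * enorm (w' - w).

Lemma near_sqr_le (R : realType) d (w : 'rV[R]_d) (M e : R) : 0 < e ->
  \forall w' \near w, M * enorm (w' - w) ^+ 2 <= e * enorm (w' - w).
Proof.
move=> e0; have M1 : 0 < `|M| + 1 by rewrite ltr_wpDl.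
apply/near_enormP; exists (e / (`|M| + 1)) => [|w']; first exact: divr_gt0.
rewrite ltr_pdivlMr// => /ltW small; rewrite expr2 mulrA.
rewrite ler_wpM2r ?enorm_ge0//; apply: le_trans small.
rewrite mulrC ler_wpM2l ?enorm_ge0//.
by apply: le_trans (ler_norm _) _; rewrite lerDl.
Qed.

(** A quadratic error is of smaller order than [enorm (w' - w)], so proximal normals are Fréchet
    normals. *)
Lemma proximal_regular_normal (R : realType) d (W : set 'rV[R]_d)
    (w n : 'rV[R]_d) (M : R) : W w ->
  (\forall w' \near w, W w' -> dot n (w' - w) <= M * enorm (w' - w) ^+ 2) ->
  regular_normal W w n.
Proof.
move=> Ww nM; split=> // e e0; apply: filterS2 nM (near_sqr_le w M e0).
by move=> w' nM small /nM /le_trans; apply.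
Qed.

(** The lower limit is a supremum of infima over punctured neighbourhoods, so it suffices to find,
    for each [e], one on which the quotient is at least [- e]. Where [f] is infinite, so is the
    quotient. *)
Lemma frechet_subdiff_near (R : realType) d (f : 'rV[R]_d -> \bar R)
    (u v : 'rV[R]_d) (a : R) : f u = a%:E ->
  (forall e : R, 0 < e -> \forall w \near u, f w = +oo%E \/
     exists2 b : R, f w = b%:E & a + dot v (w - u) - e * enorm (w - u) <= b) ->
  frechet_subdiff f u v.
Proof.
move=> fu H; split; first by rewrite /edom /= fu ltry.
apply/lee_addgt0Pr => e e0; rewrite -leeBlDr// sub0e limf_einfE.
have He := H _ e0; apply: ereal_sup_ge.
pose V := [set w | (f w = +oo%E \/
     exists2 b : R, f w = b%:E & a + dot v (w - u) - e * enorm (w - u) <= b)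
   /\ w != u].
exists (ereal_inf ((fun w => ((f w - f u - (dot v (w - u))%:E)
                             * ((enorm (w - u))^-1)%:E)%E) @` V)).
  exists V => //; rewrite /V.
  near=> w; split; near: w; [exact: cvg_within|exact: nbhs_dnbhs_neq].
apply: le_ereal_inf_tmp => _ [w [[fw|[b fw ab]] wu] <-]; rewrite fw fu.
  have : 0 < (enorm (w - u))^-1.
    rewrite invr_gt0 lt0r enorm_ge0 andbT; apply: contra wu.
    by move=> /eqP/enorm_eq0/eqP; rewrite subr_eq0.
  by move=> ?; rewrite /= gt0_mulye ?lte_fin// leey.
have w0 : 0 < enorm (w - u).
  rewrite lt0r enorm_ge0 andbT; apply: contra wu.
  by move=> /eqP/enorm_eq0/eqP; rewrite subr_eq0.
rewrite -!EFinB -EFinM lee_fin ler_pdivlMr//; lra.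
Unshelve. all: by end_near.
Qed.

Lemma frechet_limiting (R : realType) d (f : 'rV[R]_d -> \bar R)
    (u v : 'rV[R]_d) : frechet_subdiff f u v -> limiting_subdiff f u v.
Proof.
move=> fv; split; first by case: fv.
by exists (fun=> u), (fun=> v); split=> //; apply: cvg_cst.
Qed.

Lemma frechet_indic (R : realType) d (C : set 'rV[R]_d) (u v : 'rV[R]_d) :
  regular_normal C u v -> frechet_subdiff (indic_conv C) u v.
Proof.
move=> [Cu H]; apply: (@frechet_subdiff_near _ _ _ _ _ 0).
  by rewrite /indic_conv mem_set.
move=> e /H; apply: filterS => w Hw; rewrite /indic_conv.
case: ifPn => [/set_mem/Hw ?|_]; last by left.
by right; exists 0 => //; lra.
Qed.

Lemma Psi_in (R : realType) (p q r : nat) (F : 'rV[R]_(p + q + r) -> R)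
    X Y Z u : prod3 X Y Z u -> Psi F X Y Z u = (F u)%:E.
Proof.
by move=> [Xu Yu Zu]; rewrite /Psi /indic_conv !mem_set// !adde0.
Qed.

Lemma Psi_notin (R : realType) (p q r : nat) (F : 'rV[R]_(p + q + r) -> R)
    X Y Z u : ~ prod3 X Y Z u -> Psi F X Y Z u = +oo%E.
Proof.
rewrite /Psi /indic_conv => nW.
case: ifPn => [/set_mem Xu|_]; case: ifPn => [/set_mem Yu|_];
  by case: ifPn => [/set_mem Zu|_]; rewrite ?adde0//; case: nW.
Qed.

(** The sum rule for a differentiable function plus an indicator: each of the two first-order errors
    takes half of [e]. *)
Lemma frechet_Psi (R : realType) (p q r : nat) (F : 'rV[R]_(p + q + r) -> R)
    X Y Z u n : differentiable F u -> regular_normal (prod3 X Y Z) u n ->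
  frechet_subdiff (Psi F X Y Z) u (grad F u + n).
Proof.
move=> dF [Wu H]; apply: (@frechet_subdiff_near _ _ _ _ _ (F u)).
  exact: Psi_in.
move=> e e0; have e20 : 0 < e / 2 by rewrite divr_gt0.
have := H _ e20; have := differentiable_near dF e20.
apply: filterS2 => w Fw nw.
have [Ww|nWw] := pselect (prod3 X Y Z w); last by left; rewrite Psi_notin.
right; exists (F w); first exact: Psi_in.
rewrite dotDl; move: (nw Ww) Fw; rewrite ler_norml => ? /andP[]; lra.
Qed.

(** * Compactness and projection onto a closed set *)

Lemma closed_eball (R : realType) d (u : 'rV[R]_d) (r : R) :
  closed [set w | enorm (w - u) <= r].
Proof.
move=> w wc /=; rewrite leNgt; apply/negP => rw.
have e0 : 0 < enorm (w - u) - r by rewrite subr_gt0.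
have /wc[v [/= vu vw]] : nbhs w [set v | enorm (v - w) < enorm (w - u) - r].
  by apply/near_enormP; exists (enorm (w - u) - r).
have := enormD (w - v) (v - u); rewrite subrKA (enormB w v); lra.
Qed.

Lemma bounded_eball (R : realType) d (u : 'rV[R]_d) (r : R) :
  bounded_set [set w | enorm (w - u) <= r].
Proof.
exists (`|u| + r); split; first exact: num_real.
move=> M rM w /= wu; apply: le_trans (ltW rM).
rewrite -(subrK u w) (le_trans (ler_normD _ _))// addrC lerD2l.
exact: le_trans (normr_le_enorm _) wu.
Qed.

Lemma compact_eball (R : realType) d (W : set 'rV[R]_d) (u : 'rV[R]_d) (r : R) :
  closed W -> compact (W `&` [set w | enorm (w - u) <= r]).
Proof.
move=> Wc; apply: bounded_closed_compact.
  case: (bounded_eball u r) => N [Nreal Nu]; exists N; split=> // M /Nu uM w.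
  by move=> [_ /uM].
by apply: closedI => //; exact: closed_eball.
Qed.

Lemma EVT_min_enorm (R : realType) d (A : set 'rV[R]_d) (f : 'rV[R]_d -> R) :
  A !=set0 -> compact A ->
  (forall u, A u -> forall e : R, 0 < e ->
     \forall w \near u, A w -> `|f w - f u| < e) ->
  exists2 c, A c & forall w, A w -> f c <= f w.
Proof.
move=> A0 Ac fc; have [|c /set_mem Acc cmin] := @EVT_min_rV _ _ f A A0 Ac.
  apply/subspace_continuousP => u Au; apply/cvgrPdist_lt => e e0.
  have := fc u Au e e0; rewrite near_withinE; apply: filterS => w fw Aw.
  by rewrite distrC fw.
by exists c => // w Aw; apply: cmin; rewrite inE.
Qed.

(* The point [w'] is a projection of [w - t g] onto [W] for a small [t]. *)
Lemma near_regular_normal (R : realType) d (W : set 'rV[R]_d) (w g : 'rV[R]_d)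
    (s : R) : closed W -> W w -> 0 < s ->
  (\forall w' \near w, W w' -> - dot g (w' - w) <= s * enorm (w' - w)) ->
  forall del : R, 0 < del -> exists w' n : 'rV[R]_d,
    [/\ enorm (w' - w) < del, regular_normal W w' n & enorm (g + n) <= 2 * s].
Proof.
move=> Wc Ww s0 /near_enormP[del1 del1_gt0 Hs] del del0.
pose rho := Num.min del del1 / 2.
have rho0 : 0 < rho by rewrite divr_gt0// lt_min del0.
have rho_del : rho < del by rewrite /rho; case: (leP del del1); lra.
have rho_del1 : rho < del1 by rewrite /rho; case: (leP del del1); lra.
(* With this [t] the bound [2 * t * s] on the displacement of the projection equals [rho / 2], which
   keeps it off the boundary of the ball. *)
pose t := rho / (4 * s).
have t0 : 0 < t by rewrite divr_gt0// mulr_gt0.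
pose A := W `&` [set w' | enorm (w' - w) <= rho].
pose c := w - t *: g.
have A0 : A !=set0 by exists w; split=> //=; rewrite subrr enorm0 ltW.
have [|w' [Ww' /= w'rho] w'min] :=
  @EVT_min_enorm _ _ _ (fun w' => enorm (w' - c)) A0
   (@compact_eball _ _ _ w rho Wc).
  move=> u _ e e0; apply/near_enormP; exists e => // v vu _.
  rewrite ltr_norml; apply/andP; split; last first.
    have := enormD (v - u) (u - c); rewrite subrKA; lra.
  have := enormD (u - v) (v - c); rewrite subrKA (enormB u v); lra.
have sqmin v : A v -> dot (w' - c) (w' - c) <= dot (v - c) (v - c).
  by move=> /w'min; rewrite -!enorm_sqr ler_pXn2r ?nnegrE ?enorm_ge0.
have expand v : dot (v - c) (v - c) = dot (v - w') (v - w')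
    + 2 * dot (w' - c) (v - w') + dot (w' - c) (w' - c).
  rewrite -[v - c](subrKA w') !(dotDl (v - w')) !(dotDr (v - w')).
  by rewrite [dot (v - w') (w' - c)]dotC; ring.
(* [w'] is at least as close to [c] as [w], so [|w' - w|^2 <= - 2 t <g, w' - w>]; the slope
   hypothesis bounds the right side by [2 t s |w' - w|]. *)
have w'w : enorm (w' - w) <= 2 * t * s.
  have Aw : A w by split=> //=; rewrite subrr enorm0 ltW.
  have wc : w - c = t *: g by rewrite /c opprB addrC subrK.
  have w'c : w' - c = (w' - w) + t *: g by rewrite -wc subrKA.
  have := sqmin _ Aw; rewrite w'c wc !(dotDl (w' - w)) !(dotDr (w' - w)).
  rewrite dotZr (dotZl t g (w' - w)) [dot (w' - w) g]dotC.
  have := Hs w' (le_lt_trans w'rho rho_del1) Ww'.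
  have := enorm_sqr (w' - w).
  have := enorm_ge0 (w' - w).
  set a := enorm _ => a0 E1 E2 E3.
  have a2 : a ^+ 2 <= 2 * t * s * a by nra.
  by have [->|/eqP ?] := eqVneq a 0; nra.
have w'lt : enorm (w' - w) < rho.
  apply: le_lt_trans w'w _; rewrite /t.
  have -> : 2 * (rho / (4 * s)) * s = rho / 2.
    by field; rewrite gt_eqF.
  lra.
(* Being interior to the ball, [w'] is nearest to [c] among all nearby points of [W], so [c - w'] is
   a proximal normal. Dividing by [t] gives [g + n = (w - w') / t]. *)
exists w', (t^-1 *: (c - w')); split; first exact: le_lt_trans w'rho rho_del.
  apply: (@proximal_regular_normal _ _ _ _ _ (t^-1 / 2)) => //.
  apply/near_enormP; exists (rho - enorm (w' - w)); first by rewrite subr_gt0.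
  move=> v vw' Wv; have /sqmin : A v.
    split=> //=; have := enormD (v - w') (w' - w); rewrite subrKA; lra.
  rewrite (expand v) dotZl -mulrA ler_pM2l ?invr_gt0// enorm_sqr.
  rewrite -[c - w']opprB dotNl; lra.
have -> : g + t^-1 *: (c - w') = t^-1 *: (w - w').
  rewrite /c [w - _ - _]addrAC scalerBr scalerA mulVf ?gt_eqF// scale1r.
  by rewrite [LHS]addrC subrK.
rewrite enormZ gtr0_norm ?invr_gt0// enormB mulrC ler_pdivrMr//; lra.
Qed.

(** * Length of one step *)

Lemma derivable_near (R : realType) (f : R -> R) (s : R) : derivable f s 1 ->
  forall e : R, 0 < e ->
  \forall t \near s, `|f t - f s - f^`()%classic s * (t - s)| <= e * `|t - s|.
Proof.
move=> df e e0; have dff : differentiable f s by exact/derivable1_diffP.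
have /eqaddoP/(_ _ e0)/nbhs_ballP[del /= del0 H] := diff_locally dff.
apply/nbhs_ballP; exists del => // t; rewrite /ball /= distrC => ts.
have := H (t - s); rewrite /ball /= sub0r normrN => /(_ ts).
rewrite !fctE /= subrK opprD addrA; congr (`| _ - _ | <= _).
by rewrite -[in LHS](mulr1 (t - s)) linearZ /= derive1E deriveE// mulrC.
Qed.

(* The facts about a desingularizing function, extended to the left of 0 by
   its value at 0, that the step estimate uses.  The factors 1/2 and 9/8 only
   need to be fixed numbers close enough to 1. *)
Definition desing_below (R : realType) (e : R) (psi dpsi : R -> R) : Prop :=
  [/\ forall s, s < e -> forall del, 0 < del ->
        \forall t \near s, `|psi t - psi s| < del,
      psi 0 = 0,
      forall s t, s <= t -> t < e -> psi s <= psi t,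
      forall s, 0 < s -> s < e ->
        \forall t \near s, t <= s -> psi t <= psi s + dpsi s / 2 * (t - s) &
      forall s, 0 < s -> s < e -> 0 < dpsi s /\
        \forall t \near s, dpsi t <= 9 / 8 * dpsi s].

(** Composing with [Num.max 0] makes continuity at 0 two-sided, and a real [e] replaces [eta], which
    may be infinite. *)
Lemma desingularizing_below (R : realType) (eta : \bar R) (phi : R -> R) :
  (0 < eta)%E -> desingularizing eta phi ->
  exists e : R, [/\ 0 < e, (e%:E <= eta)%E &
    desing_below e (fun s => phi (Num.max 0 s)) phi^`()%classic].
Proof.
move=> eta0 [phic phi_ge0 phi0 dphi].
have [e e0 e_eta] : exists2 e : R, 0 < e & (e%:E <= eta)%E.
  case: eta eta0 {phic phi_ge0 dphi} => [r| |]//.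
    by rewrite lte_fin => r0; exists r.
  by exists 1 => //; rewrite leey.
have lt_eta s : s < e -> (s%:E < eta)%E.
  by move=> se; apply: lt_le_trans e_eta; rewrite lte_fin.
exists e; split => //; split.
- move=> s se del del0.
  have mS : 0 <= Num.max 0 s /\ ((Num.max 0 s)%:E < eta)%E.
    by rewrite le_max lexx; split=> //; apply: lt_eta; rewrite gt_max e0.
  have /cvgrPdist_lt/(_ _ del0) := (subspace_continuousP _ _).1 phic _ mS.
  rewrite near_withinE => /nbhs_ballP[r /= r0 H].
  apply/nbhs_ballP; exists (Num.min r (e - s)) => /=.
    by rewrite lt_min r0 subr_gt0.
  move=> t; rewrite /ball /= lt_min => /andP[tr tes]; rewrite distrC; apply: H.
    rewrite /ball /=; apply: le_lt_trans tr.
    have [s0|s0] := leP 0 s; have [t0|t0] := leP 0 t => //.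
    + by rewrite subr0 !ger0_norm//; lra.
    + rewrite sub0r normrN ger0_norm// distrC ger0_norm; lra.
    + by rewrite subr0 normr0.
  have te : t < e by move: tes; rewrite ltr_norml => /andP[]; lra.
  by rewrite /= le_max lexx; split=> //; apply: lt_eta; rewrite gt_max e0.
- by rewrite maxxx.
- move=> s t st te; set a := Num.max 0 s; set b := Num.max 0 t.
  have a0 : 0 <= a by rewrite /a le_max lexx.
  have ab : a <= b by rewrite /a /b; case: (leP 0 s); case: (leP 0 t); lra.
  have be : b < e by rewrite /b gt_max e0.
  have dphi' x : x \in `]a, b[ -> [/\ derivable phi x 1,
      {for x, continuous phi^`()%classic} & 0 < phi^`()%classic x].
    rewrite in_itv /= => /andP[ax xb]; apply: dphi; first exact: le_lt_trans ax.
    exact/lt_eta/(lt_trans xb).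
  apply: (@ger0_derive1_le_cc _ phi a b) => //; rewrite ?in_itv /= ?lexx ?ab//.
  + by move=> x /dphi'[].
  + by move=> x /dphi'[_ _ /ltW].
  + apply: continuous_subspaceW phic => x /=; rewrite in_itv /= => /andP[ax xb].
    by split; [exact: le_trans ax|exact/lt_eta/(le_lt_trans xb)].
- move=> s s0 se; have [dp _ p0] := dphi _ s0 (lt_eta _ se).
  (* For [t <= s], an error of half the slope times [|t - s|] leaves the other half of the slope. *)
  have p20 : 0 < phi^`()%classic s / 2 by rewrite divr_gt0.
  have := derivable_near dp p20; move: (lt_nbhsr s0).
  apply: filterS2 => t t0 H ts.
  rewrite (max_r (ltW t0)) (max_r (ltW s0)).
  move: H; rewrite ler_norml => /andP[_].
  by rewrite ler0_norm ?subr_le0//; lra.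
- move=> s s0 se; have [dp cp p0] := dphi _ s0 (lt_eta _ se); split=> //.
  have e1 : 0 < phi^`()%classic s / 8 by rewrite divr_gt0.
  have /cvgrPdist_lt/(_ _ e1) := cp; apply: filterS => t.
  by rewrite ltr_norml => /andP[]; lra.
Qed.

(** A limit of points of the preimage lies in [W] first, and [F] is continuous there. *)
Lemma closed_preimage_within (R : realType) d (W : set 'rV[R]_d)
    (F : 'rV[R]_d -> R) (B : set R) : closed W -> closed B ->
  (forall w, W w -> {for w, continuous F}) -> closed (W `&` F @^-1` B).
Proof.
move=> Wc Bc Fc w wc.
have Ww : W w by apply: Wc => V /wc[v [[? _] ?]]; exists v.
split=> //=; apply: Bc => V /(Fc _ Ww)/wc[v [[_ Bv] Vv]].
by exists (F v).
Qed.

(** Here [u] is the current iterate, [s] the next value of [F], [Fs] the limit value and [H] the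
    model gap. The two possible positions of the minimizer cost [16 * (K + A) / c] and [16]; the
    constant is their sum. *)
Lemma step_length (R : realType) d (W : set 'rV[R]_d) (F H : 'rV[R]_d -> R)
    (psi dpsi : R -> R) (u : 'rV[R]_d) (e Fs s c K A D : R) :
  closed W -> (forall w, W w -> differentiable F w) ->
  (forall w, W w -> forall del, 0 < del ->
     \forall w' \near w, W w' -> enorm (grad F w' - grad F w) <= del) ->
  desing_below e psi dpsi ->
  W u -> 0 < D -> 0 < c -> 0 < K -> 0 < A ->
  Fs <= s -> s <= F u -> F u - Fs < e ->
  (forall w n, regular_normal W w n -> enorm (w - u) < D ->
     0 < F w - Fs -> F w - Fs < e ->
     1 <= dpsi (F w - Fs) * enorm (grad F w + n)) ->
  H u <= 0 ->
  (forall w, W w -> enorm (w - u) <= D -> forall del, 0 < del ->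
     \forall w' \near w, W w' ->
       `|H w' - H w| <= (K * D + del) * enorm (w' - w)) ->
  (forall w, W w -> enorm (w - u) <= D -> F w <= s ->
     c * D ^+ 2 <= H w + A * enorm (w - u) ^+ 2) ->
  D <= (16 + 16 * (K + A) / c) * (psi (F u - Fs) - psi (s - Fs)).
Proof.
move=> Wc dF gc [psic psi0 psi_mono psi_slope dpsiP] Wu D0 c0 K0 A0 Fs_s s_Fu.
move=> Fu_e KL Hu dH model.
have KA0 : 0 < K + A by rewrite addr_gt0.
(* With [th * (K + A) = 16^-1], the penalty has slope at most 1/16 even when the slope of [H]
   carries an error [A * D], and the loss [th * A * a] below is at most [a / 16]. *)
pose th := (16 * (K + A))^-1.
have th0 : 0 < th by rewrite invr_gt0 mulr_gt0.
have thKA : th * (K + A) = 16^-1 by rewrite /th; field; rewrite gt_eqF.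
pose W1 := W `&` F @^-1` `[s, F u].
pose E := W1 `&` [set w | enorm (w - u) <= D].
have Ecompact : compact E.
  apply: compact_eball; apply: closed_preimage_within => //.
    exact: interval_closed.
  by move=> w /dF /differentiable_continuous.
have Eu : E u.
  by split; [split=> //=; rewrite in_itv /= s_Fu lexx
            |rewrite /= subrr enorm0 ltW].
pose J w := psi (F w - Fs) + 16^-1 * enorm (w - u) + th / D * Num.max 0 (H w).
have thD0 : 0 < th / D by rewrite divr_gt0.
have E_lt w : E w -> F w - Fs < e.
  move=> [[_ /=]]; rewrite in_itv /= => /andP[_ Fw] _; lra.
have maxH (x y : R) : Num.max 0 y - Num.max 0 x <= `|y - x|.
  have := ler_norm (y - x); have := normr_ge0 (y - x).
  by case: (leP 0 x); case: (leP 0 y); clear; lra.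
have [|w [[Ww +] wuD] wmin] :=
  @EVT_min_enorm _ _ E J (ex_intro _ _ Eu) Ecompact.
  move=> w [[Ww Fw] wu] del del0.
  have Fwe : F w - Fs < e by exact: E_lt.
  have del2 : 0 < del / 2 by rewrite divr_gt0.
  have /nbhs_ballP[r /= r0 Hr] := psic _ Fwe _ del2.
  (* [k] bounds the slope at [w] of the last two terms of [J], the slope of [H] being taken with
     error 1. *)
  pose k := 16^-1 + th / D * (K * D + 1).
  have k0 : 0 < k.
    apply: addr_gt0; first by rewrite invr_gt0.
    by apply: mulr_gt0 => //; apply: addr_gt0 => //; exact: mulr_gt0.
  have E2 : \forall v \near w, enorm (v - w) < del / 2 / k.
    by apply/near_enormP; exists (del / 2 / k) => //; rewrite divr_gt0.
  have E1 := differentiable_continuous_enorm (dF _ Ww) r0.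
  apply: filterS3 (dH w Ww wu 1 ltr01) E1 E2 => v dHv Fvw vw [[Wv _] _].
  have /Hr psivw : ball (F w - Fs) r (F v - Fs).
    by rewrite /ball /= distrC opprB addrA subrK.
  move: vw; rewrite ltr_pdivlMr// => vw.
  have Hvw : th / D * `|H v - H w| <= th / D * ((K * D + 1) * enorm (v - w)).
    by rewrite ler_pM2l// dHv.
  have m1 : th / D * (Num.max 0 (H v) - Num.max 0 (H w))
      <= th / D * `|H v - H w|.
    by rewrite ler_pM2l.
  have m2 : th / D * (Num.max 0 (H w) - Num.max 0 (H v))
      <= th / D * `|H v - H w|.
    by rewrite ler_pM2l// distrC.
  have t1 := enormD (v - w) (w - u); have t2 := enormD (w - v) (v - u).
  rewrite !subrKA (enormB w v) in t1 t2.
  move: psivw; rewrite !ltr_norml /J /k in vw * => /andP[p1 p2].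
  by apply/andP; split; move: p1 p2 vw Hvw m1 m2 t1 t2; clear; lra.
rewrite /= in_itv /= => /andP[s_Fw Fw_Fu].
have Jw : J w <= psi (F u - Fs).
  have := wmin _ Eu; rewrite /J subrr enorm0 (max_l Hu) !mulr0 !addr0.
  exact.
have maxw : 0 <= th / D * Num.max 0 (H w).
  by rewrite mulr_ge0 ?(ltW thD0)// le_max lexx.
have psi_s : psi (s - Fs) <= psi (F w - Fs).
  apply: psi_mono; first by rewrite lerD2r.
  by apply: E_lt; split=> //; split=> //=; rewrite in_itv /= s_Fw.
have coef0 : 0 < 16 * (K + A) / c by rewrite divr_gt0// mulr_gt0.
have := enorm_ge0 (w - u).
move: Jw; rewrite /J; set a := enorm (w - u) => Jw a0.
have drop0 : 0 <= psi (F u - Fs) - psi (s - Fs) by lra.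
(* First case, [F w] at its lower bound: [model] applies to [w], and after scaling by [th / D] its
   error is paid for by the distance term of [J]. *)
have [Fws|sFw] := leP (F w) s.
  have /model : W w by [].
  move=> /(_ wuD Fws); rewrite -/a => mod.
  have aD : A * a ^+ 2 <= A * a * D.
    by rewrite expr2 mulrA ler_wpM2l// mulr_ge0// ltW.
  have h1 : th / D * (c * D ^+ 2 - A * a * D) <= th / D * Num.max 0 (H w).
    rewrite ler_pM2l// le_max; apply/orP; right; lra.
  have e1 : th / D * (c * D ^+ 2 - A * a * D) = th * c * D - th * A * a.
    by field; rewrite gt_eqF.
  have thA : th * A * a <= 16^-1 * a.
    by rewrite ler_wpM2r// -thKA ler_pM2l// lerDr ltW.
  have h2 : th * c * D <= psi (F u - Fs) - psi (s - Fs) by lra.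
  have : D <= 16 * (K + A) / c * (psi (F u - Fs) - psi (s - Fs)).
    rewrite -(ler_pM2l (mulr_gt0 th0 c0)) (le_trans h2)//.
    suff -> : th * c * (16 * (K + A) / c * (psi (F u - Fs) - psi (s - Fs)))
       = psi (F u - Fs) - psi (s - Fs) by [].
    by rewrite /th; field; rewrite !gt_eqF.
  by rewrite mulrDl; lra.
(* Second case, [w] on the sphere: the distance term of [J] alone is worth [D / 16]. *)
have [Da|aD] := leP D a.
  have := mulr_ge0 (ltW coef0) drop0; rewrite mulrDl; lra.
(* The remaining case contradicts the KL inequality. *)
have {}Fw0 : 0 < F w - Fs by lra.
have {}Fwe : F w - Fs < e by lra.
have [dp0 dp_near] := dpsiP _ Fw0 Fwe.
set dp := dpsi (F w - Fs) in dp0 dp_near.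
(* Only points [w'] with [F w' < F w] matter; those near [w] are in [E], and
   minimality of [w] bounds the decrease of [psi (F w' - Fs)]. *)
have Fslope : \forall w' \near w, W w' ->
    F w - F w' <= (4 * dp)^-1 * enorm (w' - w).
  have /nbhs_ballP[r /= r0 Hr] := psi_slope _ Fw0 Fwe.
  have N1 : \forall w' \near w, enorm (w' - w) < D - a.
    by apply/near_enormP; exists (D - a) => //; rewrite subr_gt0.
  have N2 : \forall w' \near w, `|F w' - F w| < Num.min r (F w - s).
    apply: differentiable_continuous_enorm (dF _ Ww) _ _.
    by rewrite lt_min r0 subr_gt0.
  apply: filterS3 (dH w Ww wuD _ (mulr_gt0 A0 D0)) N1 N2 => w' dHw' w'w Fw' Ww'.
  move: Fw'; rewrite lt_min => /andP[Fw'r Fw's].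
  have dp4 : 0 <= (4 * dp)^-1 * enorm (w' - w).
    by rewrite mulr_ge0 ?enorm_ge0// invr_ge0 mulr_ge0// ltW.
  have [?|Fw'w] := leP (F w) (F w').
    by apply: le_trans dp4; rewrite subr_le0.
  have Ew' : E w'.
    split.
      split=> //=; rewrite in_itv /=; move: Fw's; rewrite ltr_norml => /andP[].
      by move: Fw'w Fw_Fu; clear; lra.
    rewrite /=; have := enormD (w' - w) (w - u); rewrite subrKA -/a.
    by move: w'w; clear; lra.
  have := wmin _ Ew'; rewrite /J -/a.
  have /Hr/= : ball (F w - Fs) r (F w' - Fs).
    by rewrite /ball /= distrC opprB addrA subrK.
  have le_F : F w' - Fs <= F w - Fs by rewrite lerD2r ltW.
  move=> /(_ le_F); rewrite -/dp => psiw'.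
  have := enormD (w' - w) (w - u); rewrite subrKA -/a => tri.
  have : th / D * (Num.max 0 (H w') - Num.max 0 (H w))
      <= 16^-1 * enorm (w' - w).
    apply: (@le_trans _ _ (th / D * ((K * D + A * D) * enorm (w' - w)))).
      by rewrite ler_pM2l// (le_trans (maxH _ _))// dHw'.
    rewrite -mulrDl -thKA le_eqVlt; apply/orP; left; apply/eqP.
    by field; rewrite gt_eqF.
  (* [psi] falls with slope at least [dp / 2], while distance and penalty rise with slope at most
     1/16 each; hence the factor 1/4. *)
  move=> m1 m2; have : dp * (F w - F w') <= 4^-1 * enorm (w' - w).
    by move: m1 m2 psiw' tri; clear; lra.
  by rewrite invfM mulrAC ler_pdivlMr// mulrC.
have sg0 : 0 < 3 / (8 * dp) by rewrite divr_gt0// mulr_gt0.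
have gslope : \forall w' \near w, W w' ->
    - dot (grad F w) (w' - w) <= 3 / (8 * dp) * enorm (w' - w).
  have d8 : 0 < (8 * dp)^-1 by rewrite invr_gt0 mulr_gt0.
  apply: filterS2 Fslope (differentiable_near (dF _ Ww) d8) => w' Fw' + Ww'.
  move: Fw' => /(_ Ww'); rewrite ler_norml => Fw' /andP[_ dFw'].
  have -> : 3 / (8 * dp) = (4 * dp)^-1 + (8 * dp)^-1.
    by field; rewrite gt_eqF.
  by rewrite mulrDl; move: Fw' dFw'; clear; lra.
have dp16 : 0 < (16 * dp)^-1 by rewrite invr_gt0 mulr_gt0.
(* The KL inequality will be used not at [w] but at a nearby point that carries a normal; close to
   [w] its hypotheses persist and [dpsi] and the gradient barely change. *)
have /near_enormP[del del0 near_w] : \forall w' \near w, W w' -> [/\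
    enorm (w' - u) < D, 0 < F w' - Fs, F w' - Fs < e,
    dpsi (F w' - Fs) <= 9 / 8 * dp &
    enorm (grad F w' - grad F w) <= (16 * dp)^-1].
  have /nbhs_ballP[r /= r0 Hr] := dp_near.
  have N1 : \forall w' \near w, enorm (w' - w) < D - a.
    by apply/near_enormP; exists (D - a) => //; rewrite subr_gt0.
  have N2 : \forall w' \near w,
      `|F w' - F w| < Num.min r (Num.min (F w - Fs) (e - (F w - Fs))).
    apply: differentiable_continuous_enorm (dF _ Ww) _ _.
    by rewrite !lt_min r0 Fw0 subr_gt0.
  apply: filterS3 (gc w Ww _ dp16) N1 N2 => w' gw' w'w Fw' Ww'.
  move: Fw'; rewrite !lt_min => /and3P[Fw'r].
  rewrite !ltr_norml => /andP[f1 f2] /andP[f3 f4]; split; last exact: gw'.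
  - have := enormD (w' - w) (w - u); rewrite subrKA -/a.
    by move: w'w; clear; lra.
  - by move: f1; clear; lra.
  - by move: f4; clear; lra.
  - by apply: Hr; rewrite /ball /= distrC opprB addrA subrK.
have [w' [n [w'w nn gn]]] := near_regular_normal Wc Ww sg0 gslope del0.
have [Ww' _] := nn.
have [w'u Fw'0 Fw'e dpw' gw'] := near_w _ w'w Ww'.
have := KL _ _ nn w'u Fw'0 Fw'e.
have -> : grad F w' + n = (grad F w' - grad F w) + (grad F w + n).
  by rewrite subrKA.
have := enormD (grad F w' - grad F w) (grad F w + n).
set v := enorm (_ + _) => v_le KLv.
(* Of the 13 units [(16 * dp)^-1], the normal accounts for 12 and the variation of the gradient for
   one; the product 117/128 is below the 1 required by KL. *)
have : 9 / 8 * dp * (13 * (16 * dp)^-1) < 1.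
  have -> : 9 / 8 * dp * (13 * (16 * dp)^-1) = 117 / 128.
    by field; rewrite gt_eqF.
  by clear; lra.
have v13 : v <= 13 * (16 * dp)^-1.
  have e1 : 2 * (3 / (8 * dp)) = 12 * (16 * dp)^-1 by field; rewrite gt_eqF.
  by move: v_le gw' gn; rewrite e1; clear; lra.
have := enorm_ge0 ((grad F w' - grad F w) + (grad F w + n)); rewrite -/v => v0.
have : dpsi (F w' - Fs) * v <= 9 / 8 * dp * (13 * (16 * dp)^-1).
  apply: (@le_trans _ _ (9 / 8 * dp * v)); first by rewrite ler_wpM2r.
  by rewrite ler_wpM2l// mulr_ge0// ltW.
by move: KLv; clear; lra.
Qed.

(** * Finite length *)

Lemma bounded_cluster (R : realType) d (W : set 'rV[R]_d)
    (u : nat -> 'rV[R]_d) (N : R) : closed W -> (forall k, W (u k)) ->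
  (forall k, enorm (u k) <= N) ->
  exists2 ub, W ub &
    forall (e : R) (m : nat), 0 < e ->
      exists2 k, (m <= k)%N & enorm (u k - ub) < e.
Proof.
move=> Wc Wu uN; have /(_ (u @ \oo)) := @compact_eball _ _ W 0 N Wc.
case=> [|ub [[Wub _] ubc]].
  by exists 0%N => // k _; split=> //=; rewrite subr0.
exists ub => // e m e0.
have nb : nbhs ub [set w | enorm (w - ub) < e] by apply/near_enormP; exists e.
have tail : (u @ \oo) (u @` [set k | (m <= k)%N]).
  by exists m => // k /= mk; exists k.
have [_ [[k mk <-] ke]] := ubc _ _ tail nb.
by exists k.
Qed.

(** [a] is nonincreasing and bounded below, so it tends to its infimum, and [c * D k ^+ 2] is at
    most the remaining gap. *)
Lemma descent_step_small (R : realType) (a D : nat -> R) (m c : R) :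
  0 < c -> (forall k, m <= a k) -> (forall k, 0 <= D k) ->
  (forall k, a k.+1 + c * D k ^+ 2 <= a k) ->
  [/\ forall k, inf (range a) <= a k,
      forall e, 0 < e ->
        exists n, forall k, (n <= k)%N -> a k - inf (range a) < e &
      forall e, 0 < e -> exists n, forall k, (n <= k)%N -> D k < e].
Proof.
move=> c0 ma D0 desc.
have anincr : {homo a : n k / (n <= k)%N >-> k <= n}.
  apply/nonincreasing_seqP => k; apply: le_trans (desc k).
  by rewrite lerDl mulr_ge0 ?sqr_ge0// ltW.
have inf_le k : inf (range a) <= a k.
  by apply: ge_inf; [exists m => _ [i _ <-]|exists k].
have a_small e : 0 < e ->
    exists n, forall k, (n <= k)%N -> a k - inf (range a) < e.
  move=> e0; have [|_ [n _ <-] an] := @inf_adherent _ (range a) _ e0.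
    by split; [exists (a 0%N), 0%N|exists m => _ [i _ <-]].
  exists n => k nk; have := anincr _ _ nk; lra.
split=> // e e0; have [|n Hn] := a_small (c * e ^+ 2).
  by rewrite mulr_gt0// exprn_gt0.
exists n => k /Hn ak; have := desc k; have := inf_le k.+1 => h1 h2.
by rewrite -(ltr_pXn2r (_ : 0 < 2)%N) ?nnegrE ?(ltW e0)// -(ltr_pM2l c0); lra.
Qed.

(** The convergence argument freed of blocks and of the algorithm. Near a cluster point,
    [step_length] bounds each step by a difference of values of [psi]; the telescoped sum both
    bounds the length and keeps the iterates near that point. *)
Lemma finite_length (R : realType) d (W : set 'rV[R]_d) (F : 'rV[R]_d -> R)
    (u : nat -> 'rV[R]_d) (N m c K A : R) :
  closed W -> (forall w, W w -> differentiable F w) ->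
  (forall w, W w -> forall del, 0 < del ->
     \forall w' \near w, W w' -> enorm (grad F w' - grad F w) <= del) ->
  (forall k, W (u k)) -> (forall k, enorm (u k) <= N) ->
  (forall k, m <= F (u k)) -> 0 < c -> 0 < K -> 0 < A ->
  (forall k, F (u k.+1) + c * enorm (u k.+1 - u k) ^+ 2 <= F (u k)) ->
  (forall k D, D = enorm (u k.+1 - u k) -> D <= 1 ->
     exists H : 'rV[R]_d -> R, [/\ H (u k) <= 0,
       forall w, W w -> enorm (w - u k) <= D -> forall del, 0 < del ->
         \forall w' \near w, W w' ->
           `|H w' - H w| <= (K * D + del) * enorm (w' - w) &
       forall w, W w -> enorm (w - u k) <= D ->
         F (u k.+1) + c * D ^+ 2 <= F w + H w + A * enorm (w - u k) ^+ 2]) ->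
  (forall ub, W ub ->
     (forall (e : R) (n : nat), 0 < e ->
        exists2 k, (n <= k)%N & enorm (u k - ub) < e) ->
     exists (rho e : R) (psi dpsi : R -> R),
       [/\ 0 < rho, 0 < e, desing_below e psi dpsi &
         forall w n, regular_normal W w n -> enorm (w - ub) < rho ->
           0 < F w - F ub -> F w - F ub < e ->
           1 <= dpsi (F w - F ub) * enorm (grad F w + n)]) ->
  exists C : R, forall n, \sum_(k < n) enorm (u k.+1 - u k) <= C.
Proof.
move=> Wc dF gc Wu uN mF c0 K0 A0 desc model KL.
pose D k := enorm (u k.+1 - u k).
have D_ge0 k : 0 <= D k by exact: enorm_ge0.
have desc1 k : F (u k.+1) <= F (u k).
  have := desc k; have : 0 <= c * D k ^+ 2 by rewrite mulr_ge0 ?sqr_ge0// ltW.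
  by rewrite /D; lra.
have [Fs_le F_small D_small] := descent_step_small c0 mF D_ge0 desc.
set Fs := inf _ in Fs_le F_small.
have [ub Wub ub_cluster] := bounded_cluster Wc Wu uN.
(* Along indices approaching [ub], the values of [F] tend to [F ub] by continuity and to [Fs] by
   monotonicity. *)
have Fub : F ub = Fs.
  apply/eqP; rewrite -subr_eq0 -normr_le0.
  apply/ler_addgt0Pr => e e0; rewrite add0r.
  have e20 : 0 < e / 2 by rewrite divr_gt0.
  have /near_enormP[del del0 Hdel] :=
    differentiable_continuous_enorm (dF _ Wub) e20.
  have [n Hn] := F_small _ e20; have [k nk /Hdel] := ub_cluster _ n del0.
  have := Hn _ nk; have := Fs_le k.
  rewrite ltr_norml ler_norml => h1 h2 /andP[h3 h4].
  by apply/andP; split; lra.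
have [rho [e [psi [dpsi [rho0 e0 psiP KLub]]]]] := KL _ Wub ub_cluster.
have [psic psi0 psi_mono _ _] := psiP.
pose C := 16 + 16 * (K + A) / c.
have C0 : 0 < C by rewrite addr_gt0// divr_gt0// mulr_gt0// addr_gt0.
pose P k := psi (F (u k) - Fs).
have rho4 : 0 < rho / 4 by rewrite divr_gt0.
have [n1 Hn1] : exists n, forall k, (n <= k)%N -> C * P k < rho / 4.
  have /nbhs_ballP[r /= r0 Hr] := psic _ e0 _ (divr_gt0 rho4 C0).
  have [n Hn] := F_small _ r0; exists n => k /Hn Fk.
  rewrite mulrC -ltr_pdivlMr//; apply: le_lt_trans (ler_norm _) _.
  rewrite -[P k]subr0 -psi0; apply: Hr; rewrite /ball /= sub0r normrN ger0_norm//.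
  by rewrite subr_ge0.
have [n2 Hn2] := F_small _ e0.
have [n3 Hn3] := D_small _ rho4.
have [n4 Hn4] := D_small _ ltr01.
(* Clustering gives an index that is past all four thresholds and at the same time close to [ub]. *)
have [k0 + uk0] := ub_cluster _ (maxn (maxn n1 n2) (maxn n3 n4)) rho4.
rewrite !geq_max => /andP[/andP[k01 k02] /andP[k03 k04]].
have P_ge0 k : (k0 <= k)%N -> 0 <= P k.
  move=> k0k; rewrite -psi0; apply: psi_mono; first by rewrite subr_ge0.
  by apply: Hn2; exact: leq_trans k0k.
have step k : (k0 <= k)%N -> enorm (u k - ub) <= rho / 2 ->
    D k <= C * (P k - P k.+1).
  move=> k0k uk.
  (* A zero step is treated apart: the penalty in [step_length] divides by the length of the
     step. *)
  have [D0|D0] := eqVneq (D k) 0.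
    rewrite D0 mulr_ge0 ?(ltW C0)// subr_ge0; apply: psi_mono.
      by rewrite lerD2r.
    by apply: Hn2; exact: leq_trans k0k.
  have {}D0 : 0 < D k by rewrite lt0r D0 D_ge0.
  have D1 : D k <= 1 by apply/ltW/Hn4; exact: leq_trans k0k.
  have Drho : D k < rho / 4 by apply: Hn3; exact: leq_trans k0k.
  have [H [Hu dH Hmodel]] := model k _ erefl D1.
  apply: (step_length Wc dF gc psiP (Wu k) D0 c0 K0 A0 (Fs_le k.+1)
            (desc1 k)) Hu dH _.
  - by apply: Hn2; exact: leq_trans k0k.
  - move=> w n nn wu; rewrite -Fub; apply: KLub => //.
    have := enormD (w - u k) (u k - ub); rewrite subrKA; lra.
  - move=> w Ww wu Fw; have := Hmodel w Ww wu; rewrite -/(D k); lra.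
(* [enorm (u k - ub) + C * P k] does not increase while the iterate is within [rho / 2], and its
   initial bound is below [rho / 2], so the iterate never leaves. *)
have capture j :
    enorm (u (k0 + j)%N - ub) + C * P (k0 + j)%N <= rho / 4 + C * P k0.
  elim: j => [|j IH]; first by rewrite addn0 lerD2r ltW.
  have k0j : (k0 <= k0 + j)%N by rewrite leq_addr.
  have uj : enorm (u (k0 + j)%N - ub) <= rho / 2.
    have := mulr_ge0 (ltW C0) (P_ge0 _ k0j); have := Hn1 _ k01; lra.
  have := step _ k0j uj; rewrite /D addnS => stepj.
  have := enormD (u (k0 + j).+1 - u (k0 + j)%N) (u (k0 + j)%N - ub).
  rewrite subrKA; lra.
have sum_le j : \sum_(k < k0 + j) D k
    <= \sum_(k < k0) D k + C * (P k0 - P (k0 + j)%N).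
  elim: j => [|j IH]; first by rewrite addn0 subrr mulr0 addr0.
  have k0j : (k0 <= k0 + j)%N by rewrite leq_addr.
  have uj : enorm (u (k0 + j)%N - ub) <= rho / 2.
    have := mulr_ge0 (ltW C0) (P_ge0 _ k0j).
    have := Hn1 _ k01; have := capture j; lra.
  have := step _ k0j uj; rewrite addnS big_ord_recr /=; lra.
exists (\sum_(k < k0) D k + C * P k0) => n.
apply: (@le_trans _ _ (\sum_(k < k0 + n) D k)).
  rewrite addnC big_split_ord /= lerDl; apply: sumr_ge0 => k _; exact: D_ge0.
apply: le_trans (sum_le n) _; rewrite lerD2l ler_pM2l// gerBl.
by apply: P_ge0; rewrite leq_addr.
Qed.

(** The increments form an absolutely convergent series, and [u] is its sequence of partial sums
    shifted by [u 0]. *)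
Lemma finite_length_cvg (R : realType) d (u : nat -> 'rV[R]_d) (C : R) :
  (forall n, \sum_(k < n) enorm (u k.+1 - u k) <= C) -> cvgn u.
Proof.
move=> HC; pose v k := u k.+1 - u k.
have : cvgn (series v).
  apply/cauchy_cvgP/cauchy_seriesP => e e0.
  have : cvgn (series (fun k => enorm (v k))).
    apply: nondecreasing_is_cvgn.
      apply/nondecreasing_seqP => n.
      by rewrite !seriesEnat /= big_nat_recr//= lerDl enorm_ge0.
    by exists C => _ [n _ <-]; rewrite seriesEnat /= big_mkord.
  move=> /cvg_cauchy/cauchy_seriesP/(_ _ e0); apply: filterS => -[n k] /=.
  apply: le_lt_trans; apply: le_trans (ler_norm_sum _ _ _) _.
  rewrite ger0_norm; first by apply: ler_sum => i _; exact: normr_le_enorm.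
  by apply: sumr_ge0 => i _; exact: enorm_ge0.
suff -> : u = series v + cst (u 0%N).
  by move=> vc; apply: is_cvgD => //; exact: is_cvg_cst.
apply/funext => n; rewrite !fctE seriesEnat /= telescope_sumr//.
by rewrite subrK.
Qed.

(** * Blocks *)

Section Triple.
Context {R : realType} {p q r : nat}.
Implicit Types (x a : 'rV[R]_p) (y b : 'rV[R]_q) (z c : 'rV[R]_r).
Implicit Types (u v w : 'rV[R]_(p + q + r)).

Lemma xpart_triple x y z : xpart (triple x y z) = x.
Proof. by rewrite /xpart /triple !row_mxKl. Qed.

Lemma ypart_triple x y z : ypart (triple x y z) = y.
Proof. by rewrite /ypart /triple row_mxKl row_mxKr. Qed.

Lemma zpart_triple x y z : zpart (triple x y z) = z.
Proof. by rewrite /zpart /triple row_mxKr. Qed.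

Definition part_triple := (xpart_triple, ypart_triple, zpart_triple).

Lemma triple_part u : triple (xpart u) (ypart u) (zpart u) = u.
Proof. by rewrite /triple /xpart /ypart /zpart !hsubmxK. Qed.

Lemma tripleD x y z a b c :
  triple x y z + triple a b c = triple (x + a) (y + b) (z + c).
Proof. by rewrite /triple !add_row_mx. Qed.

Lemma tripleB x y z a b c :
  triple x y z - triple a b c = triple (x - a) (y - b) (z - c).
Proof. by rewrite /triple !opp_row_mx !add_row_mx. Qed.

Lemma xpartB u v : xpart (u - v) = xpart u - xpart v.
Proof. by rewrite /xpart !linearB. Qed.

Lemma ypartB u v : ypart (u - v) = ypart u - ypart v.
Proof. by rewrite /ypart !linearB. Qed.

Lemma zpartB u v : zpart (u - v) = zpart u - zpart v.
Proof. by rewrite /zpart !linearB. Qed.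

Lemma dot_triple x y z a b c :
  dot (triple x y z) (triple a b c) = dot x a + dot y b + dot z c.
Proof.
rewrite /dot /triple !big_split_ord /=; congr (_ + _ + _);
  by apply: eq_bigr => i _; rewrite ?row_mxEl ?row_mxEr.
Qed.

Lemma dot_part u v :
  dot u v = dot (xpart u) (xpart v) + dot (ypart u) (ypart v)
            + dot (zpart u) (zpart v).
Proof. by rewrite -dot_triple !triple_part. Qed.

Lemma enorm_triple_sqr x y z :
  enorm (triple x y z) ^+ 2 = enorm x ^+ 2 + enorm y ^+ 2 + enorm z ^+ 2.
Proof. by rewrite !enorm_sqr dot_triple. Qed.

Lemma enorm_part_sqr u :
  enorm u ^+ 2 = enorm (xpart u) ^+ 2 + enorm (ypart u) ^+ 2
                 + enorm (zpart u) ^+ 2.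
Proof. by rewrite -enorm_triple_sqr triple_part. Qed.

Lemma enorm_xpart u : enorm (xpart u) <= enorm u.
Proof.
rewrite -(ler_pXn2r (_ : 0 < 2)%N) ?nnegrE ?enorm_ge0// (enorm_part_sqr u).
by rewrite -addrA lerDl addr_ge0// sqr_ge0.
Qed.

Lemma enorm_ypart u : enorm (ypart u) <= enorm u.
Proof.
rewrite -(ler_pXn2r (_ : 0 < 2)%N) ?nnegrE ?enorm_ge0// (enorm_part_sqr u).
by rewrite addrAC lerDr addr_ge0// sqr_ge0.
Qed.

Lemma enorm_zpart u : enorm (zpart u) <= enorm u.
Proof.
rewrite -(ler_pXn2r (_ : 0 < 2)%N) ?nnegrE ?enorm_ge0// (enorm_part_sqr u).
by rewrite lerDr addr_ge0// sqr_ge0.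
Qed.

Lemma enorm_triple_le x y z :
  enorm (triple x y z) <= enorm x + enorm y + enorm z.
Proof.
have := enorm_ge0 x; have := enorm_ge0 y; have := enorm_ge0 z => z0 y0 x0.
rewrite -(ler_pXn2r (_ : 0 < 2)%N) ?nnegrE ?enorm_ge0 ?addr_ge0//.
rewrite enorm_triple_sqr; nra.
Qed.

Lemma enorm_triple00 x y z :
  enorm (triple x (0 : 'rV_q) (0 : 'rV_r)) <= enorm (triple x y z).
Proof.
rewrite -(ler_pXn2r (_ : 0 < 2)%N) ?nnegrE ?enorm_ge0// !enorm_triple_sqr.
by rewrite !enorm0 expr0n !addr0 -addrA lerDl addr_ge0// sqr_ge0.
Qed.

Lemma enorm_triple0 x y z :
  enorm (triple x y (0 : 'rV_r)) <= enorm (triple x y z).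
Proof.
rewrite -(ler_pXn2r (_ : 0 < 2)%N) ?nnegrE ?enorm_ge0// !enorm_triple_sqr.
by rewrite !enorm0 expr0n addr0 lerDl sqr_ge0.
Qed.

(** Both sides are limits of the same difference quotients: a basis direction of the first block is
    a basis direction of the whole space. *)
Lemma gradxE (F : 'rV[R]_(p + q + r) -> R) x y z :
  gradx F x y z = xpart (grad F (triple x y z)).
Proof.
apply/rowP => i; rewrite !mxE /derive /=.
have E h : triple (h *: delta_mx 0 i + x) y z =
    h *: delta_mx 0 (lshift r (lshift q i)) + triple x y z.
  by rewrite !delta_mx_lshift /triple !scale_row_mx !scaler0 !add_row_mx !add0r.
by under eq_fun do rewrite E.
Qed.

Lemma gradyE (F : 'rV[R]_(p + q + r) -> R) x y z :
  grady F x y z = ypart (grad F (triple x y z)).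
Proof.
apply/rowP => i; rewrite !mxE /derive /=.
have E h : triple x (h *: delta_mx 0 i + y) z =
    h *: delta_mx 0 (lshift r (rshift p i)) + triple x y z.
  rewrite delta_mx_lshift delta_mx_rshift /triple.
  by rewrite !scale_row_mx !scaler0 !add_row_mx !add0r.
by under eq_fun do rewrite E.
Qed.

Lemma closed_prod3 (X : set 'rV[R]_p) (Y : set 'rV[R]_q) (Z : set 'rV[R]_r) :
  closed X -> closed Y -> closed Z -> closed (prod3 X Y Z).
Proof.
move=> Xc Yc Zc u uc; split.
- apply: Xc => V /near_enormP[e e0 eV].
  have [|w [[Xw _ _]]] := uc [set w | V (xpart w)]; last by exists (xpart w).
  apply/near_enormP; exists e => // w wu; apply: eV; rewrite -xpartB.
  exact: le_lt_trans (enorm_xpart _) wu.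
- apply: Yc => V /near_enormP[e e0 eV].
  have [|w [[_ Yw _]]] := uc [set w | V (ypart w)]; last by exists (ypart w).
  apply/near_enormP; exists e => // w wu; apply: eV; rewrite -ypartB.
  exact: le_lt_trans (enorm_ypart _) wu.
- apply: Zc => V /near_enormP[e e0 eV].
  have [|w [[_ _ Zw]]] := uc [set w | V (zpart w)]; last by exists (zpart w).
  apply/near_enormP; exists e => // w wu; apply: eV; rewrite -zpartB.
  exact: le_lt_trans (enorm_zpart _) wu.
Qed.

(** Each block of a displacement is no longer than the displacement, so each block may take
    [e / 3]. *)
Lemma regular_normal_prod3 (X : set 'rV[R]_p) (Y : set 'rV[R]_q)
    (Z : set 'rV[R]_r) x y z a b c :
  regular_normal X x a -> regular_normal Y y b -> regular_normal Z z c ->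
  regular_normal (prod3 X Y Z) (triple x y z) (triple a b c).
Proof.
move=> [Xx xa] [Yy yb] [Zz zc]; split; first by split; rewrite part_triple.
move=> e e0; have e3 : 0 < e / 3 by rewrite divr_gt0.
have /near_enormP[ex ex0 {}xa] := xa _ e3.
have /near_enormP[ey ey0 {}yb] := yb _ e3.
have /near_enormP[ez ez0 {}zc] := zc _ e3.
apply/near_enormP; exists (Num.min ex (Num.min ey ez)).
  by rewrite !lt_min ex0 ey0.
move=> w; rewrite !lt_min => /and3P[wx wy wz] [Xw Yw Zw].
have := enorm_xpart (w - triple x y z); have := enorm_ypart (w - triple x y z).
have := enorm_zpart (w - triple x y z); rewrite xpartB ypartB zpartB !part_triple.
move=> hz hy hx; rewrite dot_part xpartB ypartB zpartB !part_triple.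
have := xa _ (le_lt_trans hx wx) Xw; have := yb _ (le_lt_trans hy wy) Yw.
have := zc _ (le_lt_trans hz wz) Zw.
move: hx hy hz; rewrite -(ler_pM2l e3) => hx; rewrite -(ler_pM2l e3) => hy.
rewrite -(ler_pM2l e3); lra.
Qed.

End Triple.

(** The mean value theorem on the unit interval for [g], which is [f] along the segment minus the
    linear and quadratic terms of the bound; the Lipschitz gradient makes its derivative nonpositive
    there. *)
Lemma descent_lemma (R : realType) d (f : 'rV[R]_d -> R) (L : R)
    (x v : 'rV[R]_d) :
  cont_diff f -> lipschitz_modulus setT (grad f) L ->
  f (x + v) <= f x + dot (grad f x) v + L / 2 * enorm v ^+ 2.
Proof.
move=> [df _] Lf.
pose g (t : R) := f (t *: v + x) - (dot (grad f x) v * t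
   + L / 2 * enorm v ^+ 2 * t ^+ 2).
pose dg (t : R) := dot (grad f (t *: v + x)) v - (dot (grad f x) v
   + L * enorm v ^+ 2 * t).
have fD (t : R) : is_derive t 1 (fun t => f (t *: v + x))
    (dot (grad f (t *: v + x)) v).
  have E : (fun h : R => h^-1 *:
        (((fun t => f (t *: v + x)) \o shift t) (h *: 1) - f (t *: v + x)))
      = (fun h : R => h^-1 *:
        ((f \o shift (t *: v + x)) (h *: v) - f (t *: v + x))).
    apply/funext => h /=; congr (_ *: (f _ - _)).
    by rewrite scalerDl addrA /GRing.scale /= mulr1.
  apply: DeriveDef.
    by rewrite /derivable E; apply: diff_derivable.
  by rewrite /derive E -derive_dot.
have gD (t : R) : is_derive t 1 g (dg t).
  apply: is_deriveB.
  apply: is_derive_eq.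
  by rewrite /GRing.scale /=; field.
have gc (t : R) : {for t, continuous g}.
  by apply/differentiable_continuous/derivable1_diffP; case: (gD t).
have gcs : {within `[0, 1], continuous g}.
  by apply: continuous_subspaceT => t; exact: gc.
have [c] := MVT_segment ler01 (fun t _ => gD t) gcs.
rewrite in_itv /= => /andP[c0 c1]; rewrite subr0 mulr1 /g /dg !scale1r !scale0r.
rewrite add0r expr1n expr0n /= !mulr0 !mulr1 addr0 subr0 [v + x]addrC => gdg.
have : dot (grad f (c *: v + x) - grad f x) v <= L * enorm v ^+ 2 * c.
  apply: le_trans (dot_le_enorm _ _) _.
  have := Lf (c *: v + x) x I I; rewrite addrK enormZ ger0_norm// => Lc.
  have := ler_wpM2r (enorm_ge0 v) Lc; lra.
rewrite dotDl dotNl; lra.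
Qed.

(** * One sweep of the algorithm *)

(** The descent lemma at [xp] is added to the minimality of [xp] tested against [x']; the margin
    [2 * c] between [L] and [a] leaves the term in [c]. *)
Lemma argmin_prox_le (R : realType) d (C : set 'rV[R]_d) (g x xp x' : 'rV[R]_d)
    (f : 'rV[R]_d -> R) (L a c : R) :
  cont_diff f -> lipschitz_modulus setT (grad f) L -> g = grad f x ->
  L + 2 * c <= a ->
  argmin C (fun x' => dot (x' - x) g + a / 2 * enorm (x' - x) ^+ 2) xp ->
  C x' ->
  f xp + c * enorm (xp - x) ^+ 2
    <= f x + dot g (x' - x) + a / 2 * enorm (x' - x) ^+ 2.
Proof.
move=> df Lf -> La [_ xpmin] /xpmin.
have := descent_lemma x (xp - x) df Lf.
rewrite addrC subrK ![dot _ (grad f x)]dotC => h1 h2.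
have : (L + 2 * c) / 2 * enorm (xp - x) ^+ 2 <= a / 2 * enorm (xp - x) ^+ 2.
  by rewrite ler_wpM2r ?sqr_ge0// ler_pM2r// invr_gt0.
lra.
Qed.

(** The negative gradient of the objective at its minimizer is a proximal normal, with quadratic
    constant [a / 2]. *)
Lemma argmin_prox_normal (R : realType) d (C : set 'rV[R]_d) (g x xp : 'rV[R]_d)
    (a : R) :
  argmin C (fun x' => dot (x' - x) g + a / 2 * enorm (x' - x) ^+ 2) xp ->
  regular_normal C xp (- g - a *: (xp - x)).
Proof.
move=> [Cxp xpmin]; apply: (@proximal_regular_normal _ _ _ _ _ (a / 2)) => //.
apply/near_enormP; exists 1 => // w _ /xpmin.
have -> : w - x = (w - xp) + (xp - x) by rewrite subrKA.
rewrite (enorm_sqrD (w - xp)) [dot (w - xp) (xp - x)]dotC (dotDl (w - xp)).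
by rewrite (dotDl (- g)) dotNl (dotNl (_ *: _)) dotZl [dot g _]dotC; lra.
Qed.

(** Here [f] has only a first-order expansion at the minimizer, so the normal is obtained directly
    in the Fréchet sense. *)
Lemma argmin_normal (R : realType) d (C : set 'rV[R]_d) (f : 'rV[R]_d -> R)
    (z zp g : 'rV[R]_d) (gamma : R) :
  (forall e : R, 0 < e -> \forall w \near zp,
     `|f w - f zp - dot g (w - zp)| <= e * enorm (w - zp)) ->
  argmin C (fun z' => f z' + gamma / 2 * enorm (z' - z) ^+ 2) zp ->
  regular_normal C zp (- g - gamma *: (zp - z)).
Proof.
move=> df [Czp zpmin]; split=> // e e0.
have e2 : 0 < e / 2 by rewrite divr_gt0.
apply: filterS2 (df _ e2) (near_sqr_le zp (gamma / 2) e2) => w dfw small /zpmin.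
have -> : w - z = (w - zp) + (zp - z) by rewrite subrKA.
rewrite (enorm_sqrD (w - zp)) [dot (w - zp) (zp - z)]dotC.
rewrite (dotDl (- g)) dotNl (dotNl (_ *: _)) dotZl.
by move: dfw; rewrite ler_norml => /andP[]; lra.
Qed.

(** The three block inequalities are added; the value of [F] at the half-updated point
    [triple xp y z] cancels. *)
Lemma block_step_le (R : realType) p q r (F : 'rV[R]_(p + q + r) -> R)
    (X : set 'rV[R]_p) (Y : set 'rV[R]_q) (Z : set 'rV[R]_r)
    x y z xp yp zp (Lx Ly a b gamma c : R) w :
  cont_diff (fun x' => F (triple x' y z)) ->
  lipschitz_modulus setT (fun x' => gradx F x' y z) Lx ->
  cont_diff (fun y' => F (triple xp y' z)) ->
  lipschitz_modulus setT (fun y' => grady F xp y' z) Ly ->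
  Lx + 2 * c <= a -> Ly + 2 * c <= b -> 2 * c <= gamma ->
  argmin X (fun x' => dot (x' - x) (gradx F x y z)
                      + a / 2 * enorm (x' - x) ^+ 2) xp ->
  argmin Y (fun y' => dot (y' - y) (grady F xp y z)
                      + b / 2 * enorm (y' - y) ^+ 2) yp ->
  argmin Z (fun z' => F (triple xp yp z')
                      + gamma / 2 * enorm (z' - z) ^+ 2) zp ->
  prod3 X Y Z w ->
  F (triple xp yp zp) + c * enorm (triple xp yp zp - triple x y z) ^+ 2 <=
  F (triple x y z) + dot (gradx F x y z) (xpart w - x)
  + dot (grady F xp y z) (ypart w - y)
  + (F (triple xp yp (zpart w)) - F (triple xp yp z))
  + (a / 2 * enorm (xpart w - x) ^+ 2 + b / 2 * enorm (ypart w - y) ^+ 2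
     + gamma / 2 * enorm (zpart w - z) ^+ 2).
Proof.
move=> dx Lipx dy Lipy La Lb cg xmin ymin [_ zmin] [Xw Yw Zw].
have := argmin_prox_le dx Lipx erefl La xmin Xw.
have := argmin_prox_le dy Lipy erefl Lb ymin Yw.
have /= := zmin _ Zw.
have : 2 * c / 2 * enorm (zp - z) ^+ 2 <= gamma / 2 * enorm (zp - z) ^+ 2.
  by rewrite ler_wpM2r ?sqr_ge0// ler_pM2r// invr_gt0.
rewrite tripleB enorm_triple_sqr; lra.
Qed.

(* [F w + model_gap w] is, up to quadratic terms and constants, the sum of what
   the three argmins of one sweep minimize. *)
Definition model_gap (R : realType) p q r (F : 'rV[R]_(p + q + r) -> R)
    x y z xp yp (w : 'rV[R]_(p + q + r)) : R :=
  F (triple x y z) + dot (gradx F x y z) (xpart w - x)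
  + dot (grady F xp y z) (ypart w - y)
  + (F (triple xp yp (zpart w)) - F (triple xp yp z)) - F w.

(** The blocks of the gradient of [model_gap] at [w] are differences of partial gradients of [F]
    between [w] and points at distance at most [D], [2 * D] and [2 * D]; hence the factor 5. *)
Lemma model_gap_slope (R : realType) p q r (F : 'rV[R]_(p + q + r) -> R)
    (X : set 'rV[R]_p) (Y : set 'rV[R]_q) (Z : set 'rV[R]_r)
    x y z xp yp zp (D M N : R) w del :
  (forall v, prod3 X Y Z v -> differentiable F v) ->
  (forall v v', prod3 X Y Z v -> prod3 X Y Z v' ->
     enorm v <= N + 3 * D -> enorm v' <= N + 3 * D ->
     enorm (grad F v - grad F v') <= M * enorm (v - v')) ->
  0 < M ->
  prod3 X Y Z (triple x y z) -> prod3 X Y Z (triple xp yp zp) ->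
  enorm (triple x y z) <= N -> enorm (triple xp yp zp - triple x y z) = D ->
  prod3 X Y Z w -> enorm (w - triple x y z) <= D -> 0 < del ->
  \forall w' \near w, prod3 X Y Z w' ->
    `|model_gap F x y z xp yp w' - model_gap F x y z xp yp w|
      <= (5 * M * D + del) * enorm (w' - w).
Proof.
move=> dF Lip M0 Wu Wup uN upD Ww wu del0.
have D0 : 0 <= D by rewrite -upD enorm_ge0.
have [Xx Yy Zz] := Wu; have [Xxp Yyp Zzp] := Wup; have [Xw Yw Zw] := Ww.
rewrite !part_triple in Xx Yy Zz Xxp Yyp Zzp.
set u := triple x y z in wu uN Wu *.
(* Points with mixed blocks stay in the constraint set because it is a product, so the Lipschitz
   bound on the gradient reaches them. *)
pose v1 := triple xp y z; pose v2 := triple xp yp (zpart w).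
have Wv1 : prod3 X Y Z v1 by split; rewrite part_triple.
have Wv2 : prod3 X Y Z v2 by split; rewrite part_triple.
rewrite tripleB in upD.
have v1w : enorm (v1 - w) <= 2 * D.
  have := enormD (v1 - u) (u - w); rewrite subrKA (enormB u w) tripleB !subrr.
  have := enorm_triple00 (xp - x) (yp - y) (zp - z); lra.
have v2w : enorm (v2 - w) <= 2 * D.
  have -> : v2 - w = triple (xp - x) (yp - y) 0
      + triple (x - xpart w) (y - ypart w) 0.
    by rewrite tripleD !subrKA addr0 -[w in LHS]triple_part tripleB subrr.
  have := enormD (triple (xp - x) (yp - y) (0 : 'rV_r))
            (triple (x - xpart w) (y - ypart w) 0).
  have := enorm_triple0 (xp - x) (yp - y) (zp - z).
  have := enorm_triple0 (x - xpart w) (y - ypart w) (z - zpart w).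
  rewrite -tripleB triple_part -/u (enormB u w); lra.
have wN : enorm w <= N + D.
  by have := enormD (w - u) u; rewrite subrK; lra.
have v1N : enorm v1 <= N + 3 * D.
  by have := enormD (v1 - w) w; rewrite subrK; lra.
have v2N : enorm v2 <= N + 3 * D.
  by have := enormD (v2 - w) w; rewrite subrK; lra.
have gx : enorm (gradx F x y z - xpart (grad F w)) <= M * D.
  rewrite gradxE -/u -xpartB; apply: le_trans (enorm_xpart _) _.
  have := Lip u w Wu Ww; rewrite (enormB u w) => h.
  apply: le_trans (h _ _) _; [lra|lra|]; by rewrite ler_pM2l.
have gy : enorm (grady F xp y z - ypart (grad F w)) <= M * (2 * D).
  rewrite gradyE -/v1 -ypartB; apply: le_trans (enorm_ypart _) _.
  apply: le_trans (Lip v1 w Wv1 Ww v1N _) _; [lra|]; by rewrite ler_pM2l.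
have gz : enorm (zpart (grad F v2) - zpart (grad F w)) <= M * (2 * D).
  rewrite -zpartB; apply: le_trans (enorm_zpart _) _.
  apply: le_trans (Lip v2 w Wv2 Ww v2N _) _; [lra|]; by rewrite ler_pM2l.
(* The slack [del] is shared by the first-order errors of [F] at [v2] and at [w]. *)
have del2 : 0 < del / 2 by rewrite divr_gt0.
have /near_enormP[e e0 He] := differentiable_near (dF _ Wv2) del2.
have N1 : \forall w' \near w, enorm (w' - w) < e by apply/near_enormP; exists e.
apply: filterS2 (differentiable_near (dF _ Ww) del2) N1 => w' dFw w'w _.
have v2' : triple xp yp (zpart w') - v2 = triple 0 0 (zpart (w' - w)).
  by rewrite tripleB !subrr zpartB.
have v2'le : enorm (triple xp yp (zpart w') - v2) <= enorm (w' - w).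
  rewrite v2'; apply: le_trans (enorm_triple_le _ _ _) _.
  by rewrite !enorm0 !add0r enorm_zpart.
have := He _ (le_lt_trans v2'le w'w).
rewrite v2' dot_part !part_triple !dot0r !add0r.
rewrite -v2' => dFv2; rewrite /model_gap.
set dx := xpart (w' - w); set dy := ypart (w' - w); set dz := zpart (w' - w).
have Ex : xpart w' - x = (xpart w - x) + dx.
  by rewrite /dx xpartB [RHS]addrC subrKA.
have Ey : ypart w' - y = (ypart w - y) + dy.
  by rewrite /dy ypartB [RHS]addrC subrKA.
rewrite Ex Ey !(dotDr (_ - _)).
have bx := normr_dot_le (gradx F x y z - xpart (grad F w)) dx.
have by_ := normr_dot_le (grady F xp y z - ypart (grad F w)) dy.
have bz := normr_dot_le (zpart (grad F v2) - zpart (grad F w)) dz.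
have bx' : enorm (gradx F x y z - xpart (grad F w)) * enorm dx
    <= M * D * enorm (w' - w).
  by rewrite ler_pM ?enorm_ge0// enorm_xpart.
have by' : enorm (grady F xp y z - ypart (grad F w)) * enorm dy
    <= M * (2 * D) * enorm (w' - w).
  by rewrite ler_pM ?enorm_ge0// enorm_ypart.
have bz' : enorm (zpart (grad F v2) - zpart (grad F w)) * enorm dz
    <= M * (2 * D) * enorm (w' - w).
  by rewrite ler_pM ?enorm_ge0// enorm_zpart.
have bv2 : del / 2 * enorm (triple xp yp (zpart w') - v2)
    <= del / 2 * enorm (w' - w).
  by rewrite ler_pM2l.
move: dFw dFv2 bx by_ bz; rewrite (dot_part (grad F w)) -/dx -/dy -/dz -/v2.
rewrite !dotDl !dotNl !ler_norml => /andP[f1 f2] /andP[f3 f4] /andP[f5 f6].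
move=> /andP[f7 f8] /andP[f9 f10].
apply/andP; split; lra.
Qed.

(** * Limiting subgradients and the KL inequality in terms of normals *)

Lemma limiting_indic (R : realType) d (C : set 'rV[R]_d)
    (us ns : nat -> 'rV[R]_d) (u n : 'rV[R]_d) :
  C u -> (forall k, regular_normal C (us k) (ns k)) ->
  us @ \oo --> u -> ns @ \oo --> n -> limiting_subdiff (indic_conv C) u n.
Proof.
move=> Cu nn usu nsn.
have indic0 w : C w -> indic_conv C w = 0%E.
  by move=> Cw; rewrite /indic_conv mem_set.
split; first by rewrite /edom /= indic0// ltry.
exists us, ns; split=> //; last by move=> k; exact: frechet_indic.
rewrite indic0// (_ : _ \o _ = cst 0%E); first exact: cvg_cst.
by apply/funext => k /=; rewrite indic0//; case: (nn k).
Qed.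

(** Cluster points are critical, which puts them in [dom_subdiff], where the KL property is assumed.
    The vectors [grad F (u k) + n k] are the subgradients tending to 0. *)
Lemma limiting_Psi_0 (R : realType) p q r (F : 'rV[R]_(p + q + r) -> R) X Y Z
    (u n : nat -> 'rV[R]_(p + q + r)) ub :
  (forall w, prod3 X Y Z w -> differentiable F w) -> prod3 X Y Z ub ->
  (forall k, regular_normal (prod3 X Y Z) (u k) (n k)) ->
  (forall (e : R) m, 0 < e -> exists2 k, (m <= k)%N & enorm (u k - ub) < e) ->
  (forall e, 0 < e -> exists m, forall k, (m <= k)%N ->
     enorm (grad F (u k) + n k) < e) ->
  limiting_subdiff (Psi F X Y Z) ub 0.
Proof.
move=> dF Wub nn uub n0.
split; first by rewrite /edom /= Psi_in// ltry.
have /choice[f Hf] j : exists k, (j <= k)%N /\ enorm (u k - ub) < j.+1%:R^-1.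
  have j0 : 0 < j.+1%:R^-1 :> R by rewrite invr_gt0.
  by have [k jk kj] := uub _ j j0; exists k.
have ufub : (u \o f) @ \oo --> ub.
  apply/cvg_enormP => e e0; have := near_infty_natSinv_lt (PosNum e0).
  by apply: filterS => j /=; apply: lt_trans; case: (Hf j).
exists (u \o f), (fun j => grad F (u (f j)) + n (f j)); split => //.
- rewrite Psi_in// (_ : _ \o _ = EFin \o (F \o (u \o f))); last first.
    by apply/funext => j /=; rewrite Psi_in//; case: (nn (f j)).
  apply/cvg_EFin; first exact: nearW.
  have /differentiable_continuous Fc := dF _ Wub.
  exact: (cvg_comp _ _ ufub Fc).
- apply/cvg_enormP => e /n0[m Hm]; exists m => // j /= mj; rewrite subr0.
  exact: (Hm _ (leq_trans mj (proj1 (Hf j)))).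
- by move=> j; apply: frechet_Psi; [apply: dF; case: (nn (f j))|exact: nn].
Qed.

(** [grad F w + n] is a subgradient of [Psi] at [w], so its norm is at least the distance from 0 to
    the subdifferential. *)
Lemma KL_regular_normal (R : realType) p q r (F : 'rV[R]_(p + q + r) -> R)
    X Y Z ub :
  (forall w, prod3 X Y Z w -> differentiable F w) -> prod3 X Y Z ub ->
  KL_at (Psi F X Y Z) ub ->
  exists (rho e : R) (psi dpsi : R -> R),
    [/\ 0 < rho, 0 < e, desing_below e psi dpsi &
      forall w n, regular_normal (prod3 X Y Z) w n -> enorm (w - ub) < rho ->
        0 < F w - F ub -> F w - F ub < e ->
        1 <= dpsi (F w - F ub) * enorm (grad F w + n)].
Proof.
move=> dF Wub [eta [U [phi [eta0 /near_enormP[rho rho0 HU] dphi KL]]]].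
have [e [e0 e_eta phie]] := desingularizing_below eta0 dphi.
exists rho, e, (fun s => phi (Num.max 0 s)), phi^`()%classic.
split=> // w n nn wub Fw0 Fwe.
have Ww : prod3 X Y Z w by case: nn.
have [_ _ _ _ dphi_gt0] := phie.
have [dpos _] := dphi_gt0 _ Fw0 Fwe.
have := KL w (HU _ wub); rewrite !Psi_in//= lte_fin -subr_gt0 => /(_ Fw0).
have -> : (F w)%:E = (F ub + (F w - F ub))%:E by rewrite addrC subrK.
rewrite EFinD lteD2lE// => /(_ (lt_le_trans _ e_eta)); rewrite lte_fin Fwe.
move=> /(_ isT).
move=> /= h; rewrite -lee_fin EFinM; apply: le_trans h _.
rewrite lee_pmul2l ?lte_fin//; apply: ge_ereal_inf.
exists (enorm (0 - (grad F w + n)))%:E; last by rewrite sub0r enormN.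
exists (grad F w + n) => //.
apply/frechet_limiting/frechet_Psi => //; exact: dF.
Qed.

(** * Summability, Lipschitz constants on balls and residual bounds *)

Lemma finite_length_eseries (R : realType) (D : nat -> R) (C : R) :
  (forall k, 0 <= D k) -> (forall n, \sum_(k < n) D k <= C) ->
  (\sum_(1 <= k <oo) (D k)%:E < +oo)%E.
Proof.
move=> D0 DC; apply: (@le_lt_trans _ _ C%:E); last exact: ltry.
apply: lime_le.
  by apply: is_cvg_nneseries => k _ _; rewrite lee_fin.
apply: nearW => -[|n]; rewrite sumEFin lee_fin.
  by rewrite big_geq// (le_trans _ (DC 0%N))// big_ord0.
apply: le_trans (DC n.+1).
by rewrite -(big_mkord xpredT D) [leRHS]big_ltn// lerDr.
Qed.

Lemma grad_lipschitz_eball (R : realType) d (W : set 'rV[R]_d)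
    (F : 'rV[R]_d -> R) :
  (forall B : set 'rV[R]_d, B `<=` W -> bounded_set B ->
     exists M : R, lipschitz_modulus B (grad F) M) ->
  forall N : R, exists2 M, 0 < M & forall v v', W v -> W v' ->
    enorm v <= N -> enorm v' <= N ->
    enorm (grad F v - grad F v') <= M * enorm (v - v').
Proof.
move=> gradF_lip N.
have [|M HM] :=
  gradF_lip (W `&` [set w | enorm (w - 0) <= N]) (@subIsetl _ _ _).
  case: (bounded_eball (0 : 'rV[R]_d) N) => K [Kreal NK].
  exists K; split=> // K' /NK uK w.
  by move=> [_ /uK].
exists (`|M| + 1) => [|v v' Wv Wv' vN v'N]; first by rewrite ltr_wpDl.
apply: (le_trans (HM v v' _ _)); rewrite /= ?subr0//.
by rewrite ler_wpM2r ?enorm_ge0// (le_trans (ler_norm _))// lerDl.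
Qed.

Lemma grad_continuous_within (R : realType) d (W : set 'rV[R]_d)
    (F : 'rV[R]_d -> R) :
  (forall N : R, exists2 M, 0 < M & forall v v', W v -> W v' ->
    enorm v <= N -> enorm v' <= N ->
    enorm (grad F v - grad F v') <= M * enorm (v - v')) ->
  forall w, W w -> forall del, 0 < del ->
    \forall w' \near w, W w' -> enorm (grad F w' - grad F w) <= del.
Proof.
move=> Lip w Ww del del0; have [M M0 HM] := Lip (enorm w + 1).
apply/near_enormP; exists (Num.min 1 (del / M)).
  by rewrite lt_min ltr01 divr_gt0.
move=> w'; rewrite lt_min => /andP[w'1 w'del] Ww'.
have := enormD (w' - w) w; rewrite subrK => w'w.
apply: le_trans (HM w' w Ww' Ww _ _) _; [lra|lra|].
by rewrite mulrC -ler_pdivlMr// ltW.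
Qed.

(** The gradient cancels in the [z] block. The [x] and [y] blocks compare it at the new point with
    the old and the half-updated point, each costing [M * D]. *)
Lemma block_residual_le (R : realType) p q r (F : 'rV[R]_(p + q + r) -> R)
    (X : set 'rV[R]_p) (Y : set 'rV[R]_q) (Z : set 'rV[R]_r)
    x y z xp yp zp (a b gamma amax bmax M N : R) :
  let D := enorm (triple xp yp zp - triple x y z) in
  (forall v v', prod3 X Y Z v -> prod3 X Y Z v' ->
     enorm v <= N -> enorm v' <= N ->
     enorm (grad F v - grad F v') <= M * enorm (v - v')) ->
  0 < M -> 0 < a -> a <= amax -> 0 < b -> b <= bmax -> 0 < gamma ->
  prod3 X Y Z (triple x y z) -> prod3 X Y Z (triple xp yp zp) ->
  enorm (triple x y z) + D <= N ->
  enorm (grad F (triple xp yp zp)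
         + triple (- gradx F x y z - a *: (xp - x))
                  (- grady F xp y z - b *: (yp - y))
                  (- zpart (grad F (triple xp yp zp)) - gamma *: (zp - z)))
    <= (2 * M + amax + bmax + gamma) * D.
Proof.
move=> D HM M0 a0 a_le b0 b_le gamma0 Wu Wup uN.
pose v1 := triple xp y z.
have Wv1 : prod3 X Y Z v1.
  have [_ Yy Zz] := Wu; have [Xxp _ _] := Wup.
  by rewrite !part_triple in Xxp Yy Zz; split; rewrite part_triple.
have DE : D = enorm (triple (xp - x) (yp - y) (zp - z)) by rewrite /D tripleB.
have D0 : 0 <= D by exact: enorm_ge0.
have upN : enorm (triple xp yp zp) <= N.
  have := enormD (triple xp yp zp - triple x y z) (triple x y z).
  by rewrite subrK -/D; move: uN; clear; lra.
have v1N : enorm v1 <= N.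
  have := enormD (v1 - triple x y z) (triple x y z); rewrite subrK tripleB !subrr.
  have := enorm_triple00 (xp - x) (yp - y) (zp - z); rewrite -DE.
  by move: uN; clear; lra.
have {}uN : enorm (triple x y z) <= N by move: uN D0; clear; lra.
have uv1 : enorm (triple xp yp zp - v1) <= D.
  rewrite tripleB subrr DE -(ler_pXn2r (_ : 0 < 2)%N) ?nnegrE ?enorm_ge0//.
  by rewrite !enorm_triple_sqr enorm0 expr0n add0r -addrA lerDr sqr_ge0.
have gx := le_trans (enorm_xpart _) (HM _ _ Wup Wu upN uN).
have gy := le_trans (enorm_ypart _) (HM _ _ Wup Wv1 upN v1N).
have {}gy := le_trans gy (ler_wpM2l (ltW M0) uv1).
rewrite -/D in gx.
have dx := enorm_xpart (triple (xp - x) (yp - y) (zp - z)).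
have dy := enorm_ypart (triple (xp - x) (yp - y) (zp - z)).
have dz := enorm_zpart (triple (xp - x) (yp - y) (zp - z)).
rewrite part_triple -DE in dx; rewrite part_triple -DE in dy.
rewrite part_triple -DE in dz.
have adx : a * enorm (xp - x) <= amax * D by rewrite ler_pM ?enorm_ge0// ltW.
have bdy : b * enorm (yp - y) <= bmax * D by rewrite ler_pM ?enorm_ge0// ltW.
have gdz : gamma * enorm (zp - z) <= gamma * D by rewrite ler_pM2l.
set g := grad F (triple xp yp zp) in gx gy *.
rewrite xpartB in gx; rewrite ypartB in gy.
rewrite gradxE gradyE -/v1 -{1}(triple_part g) tripleD !addrA subrr sub0r.
apply: le_trans (enorm_triple_le _ _ _) _.
rewrite (enormN (gamma *: _)) enormZ (gtr0_norm gamma0).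
have := enormD (xpart g - xpart (grad F (triple x y z))) (- (a *: (xp - x))).
have := enormD (ypart g - ypart (grad F v1)) (- (b *: (yp - y))).
rewrite !enormN !enormZ !(gtr0_norm a0) !(gtr0_norm b0).
by rewrite !mulrDl; move: gx gy adx bdy gdz; clear; lra.
Qed.

Lemma block_quadratic_le (R : realType) p q r (w u : 'rV[R]_(p + q + r))
    (a b gamma amax bmax : R) :
  0 < a -> a <= amax -> 0 < b -> b <= bmax -> 0 < gamma ->
  a / 2 * enorm (xpart w - xpart u) ^+ 2
    + b / 2 * enorm (ypart w - ypart u) ^+ 2
    + gamma / 2 * enorm (zpart w - zpart u) ^+ 2
  <= (amax + bmax + gamma) * enorm (w - u) ^+ 2.
Proof.
move=> a0 a_le b0 b_le gamma0.
have half (s smax t : R) : 0 < s -> s <= smax -> 0 <= t -> t <= enorm (w - u) ->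
    s / 2 * t ^+ 2 <= smax * enorm (w - u) ^+ 2.
  move=> s0 ss t0 tw; apply: ler_pM; rewrite ?sqr_ge0 ?divr_ge0 ?(ltW s0)//.
    by move: s0 ss; clear; lra.
  by rewrite ler_pXn2r ?nnegrE ?enorm_ge0.
rewrite !mulrDl -xpartB -ypartB -zpartB !lerD//; apply: half => //;
  by rewrite ?enorm_ge0 ?enorm_xpart ?enorm_ypart ?enorm_zpart.
Qed.

(** * Finite length and convergence of the algorithm *)

Theorem theorem3p7 (R : realType) (p q r : nat)
    (X : set 'rV[R]_p) (Y : set 'rV[R]_q) (Z : set 'rV[R]_r)
    (F : 'rV[R]_(p + q + r) -> R)
    (Lx : 'rV[R]_q -> 'rV[R]_r -> R) (Ly : 'rV[R]_p -> 'rV[R]_r -> R)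
    (etax etay alpha beta gamma : R)
    (x : nat -> 'rV[R]_p) (y : nat -> 'rV[R]_q) (z : nat -> 'rV[R]_r)
    (etax_gt0 : 0 < etax) (etay_gt0 : 0 < etay)
    (alpha_gt1 : 1 < alpha) (beta_gt1 : 1 < beta) (gamma_gt0 : 0 < gamma)
    (run : block_imex F X Y Z Lx Ly etax etay alpha beta gamma x y z)
    (X_neq0 : X !=set0) (Y_neq0 : Y !=set0) (Z_neq0 : Z !=set0)
    (X_closed : closed X) (Y_closed : closed Y) (Z_closed : closed Z)
    (F_diff : forall u, prod3 X Y Z u -> differentiable F u)
    (F_inf : (-oo < ereal_inf [set (F u)%:E | u in setT])%E)
    (F_x : forall y' z', cont_diff (fun x' => F (triple x' y' z')) /\
       lipschitz_modulus setT (fun x' => gradx F x' y' z') (Lx y' z'))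
    (F_y : forall x' z', cont_diff (fun y' => F (triple x' y' z')) /\
       lipschitz_modulus setT (fun y' => grady F x' y' z') (Ly x' z'))
    (gradF_lip : forall B : set 'rV[R]_(p + q + r),
       B `<=` prod3 X Y Z -> bounded_set B ->
       exists M : R, lipschitz_modulus B (grad F) M)
    (L_bounded : exists lambdax lambday : R,
       [/\ 0 < lambdax, 0 < lambday,
           (ereal_sup [set (Lx (y k) (z k))%:E | k in setT] <= lambdax%:E)%E &
           (ereal_sup [set (Ly (x k.+1) (z k))%:E | k in setT]
              <= lambday%:E)%E])
    (iter_bounded : bounded_set [set triple (x k) (y k) (z k) | k in setT])
    (Psi_KL : KL_function (Psi F X Y Z)) :
  (\sum_(1 <= k <oo)
     (enorm (triple (x k.+1) (y k.+1) (z k.+1)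
             - triple (x k) (y k) (z k)))%:E < +oo)%E /\
  exists (xs : 'rV[R]_p) (ys : 'rV[R]_q) (zs : 'rV[R]_r),
    triple (x k) (y k) (z k) @[k --> \oo] --> triple xs ys zs /\
    [set grad F (triple xs ys zs) + v | v in
       prod3 (limiting_subdiff (indic_conv X) xs)
             (limiting_subdiff (indic_conv Y) ys)
             (limiting_subdiff (indic_conv Z) zs)] 0.
Proof.
case: run => Xx0 Yy0 Zz0 run.
have [lx [ly [lx0 ly0 supx supy]]] := L_bounded.
have Lx_le k : Lx (y k) (z k) <= lx.
  by rewrite -lee_fin; apply: le_trans supx; apply: ereal_sup_ubound; exists k.
have Ly_le k : Ly (x k.+1) (z k) <= ly.
  by rewrite -lee_fin; apply: le_trans supy; apply: ereal_sup_ubound; exists k.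
pose a k := alpha * Num.max (Lx (y k) (z k)) etax.
pose b k := beta * Num.max (Ly (x k.+1) (z k)) etay.
(* A sum of positive bounds dominates the maximum in the definition of each step parameter. *)
pose amax := alpha * (lx + etax); pose bmax := beta * (ly + etay).
have a_le k : a k <= amax.
  rewrite /a /amax ler_pM2l; last lra.
  by rewrite ge_max; have := Lx_le k => ?; apply/andP; split; lra.
have b_le k : b k <= bmax.
  rewrite /b /bmax ler_pM2l; last lra.
  by rewrite ge_max; have := Ly_le k => ?; apply/andP; split; lra.
(* Since [alpha > 1], [a k] exceeds [Lx] by at least [(alpha - 1) * etax], and likewise for [b k];
   [c] is half the smallest of these margins and [gamma]. *)
pose c := Num.min ((alpha - 1) * etax / 2)
            (Num.min ((beta - 1) * etay / 2) (gamma / 2)).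
have c0 : 0 < c by rewrite !lt_min !divr_gt0 ?mulr_gt0 ?subr_gt0.
have [ca cb cg] : [/\ 2 * c <= (alpha - 1) * etax, 2 * c <= (beta - 1) * etay
    & 2 * c <= gamma].
  have := lexx c; rewrite {2}/c !le_min => /and3P[]; split; lra.
have Lxa k : Lx (y k) (z k) + 2 * c <= a k.
  rewrite /a; set l := Num.max _ _.
  have : Lx (y k) (z k) <= l by rewrite le_max lexx.
  have : etax <= l by rewrite le_max lexx orbT.
  have : 0 < alpha - 1 by rewrite subr_gt0.
  move: ca; nra.
have Lyb k : Ly (x k.+1) (z k) + 2 * c <= b k.
  rewrite /b; set l := Num.max _ _.
  have : Ly (x k.+1) (z k) <= l by rewrite le_max lexx.
  have : etay <= l by rewrite le_max lexx orbT.
  have : 0 < beta - 1 by rewrite subr_gt0.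
  move: cb; nra.
have a0 k : 0 < a k.
  by apply: mulr_gt0; [lra|rewrite lt_max etax_gt0 orbT].
have b0 k : 0 < b k.
  by apply: mulr_gt0; [lra|rewrite lt_max etay_gt0 orbT].
pose u k := triple (x k) (y k) (z k); pose D k := enorm (u k.+1 - u k).
have D_ge0 k : 0 <= D k by exact: enorm_ge0.
pose W := prod3 X Y Z.
have Wu k : W (u k).
  case: k => [|k]; first by split; rewrite part_triple.
  by have [[? _] [? _] [? _]] := run k; split; rewrite part_triple.
have Wc : closed W by exact: closed_prod3.
have Lip := grad_lipschitz_eball gradF_lip.
have gc := grad_continuous_within Lip.
have [N N0 uN] : exists2 N, 0 <= N & forall k, enorm (u k) <= N.
  have [N [_ HN]] := iter_bounded.
  exists ((p + q + r)%:R * (`|N| + 1)); first by rewrite mulr_ge0// addr_ge0.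
  move=> k; apply: le_trans (enorm_le_normr _) _; rewrite ler_wpM2l//.
  by apply: HN; [rewrite (le_lt_trans (ler_norm _))// ltrDl|exists k].
(* The radius serves two uses: [N + 3 * D] with [D <= 1] for the model gap, and [N + D] with
   [D <= 2 * N] for the residual. *)
have [M M0 HM] := Lip (3 * N + 3).
have [m mF] : exists m, forall w, m <= F w.
  have [m_ mlt] : exists m : R, (m%:E < ereal_inf [set (F w)%:E | w in setT])%E.
    case: (ereal_inf _) F_inf => [i| |]// _; last by exists 0; exact: ltry.
    by exists (i - 1); rewrite lte_fin gtrBl.
  exists m_ => w; rewrite -lee_fin; apply: le_trans (ltW mlt) _.
  by apply: ereal_inf_lbound; exists w.
pose H k := model_gap F (x k) (y k) (z k) (x k.+1) (y k.+1).
have step k w : W w -> F (u k.+1) + c * D k ^+ 2 <= F w + H k w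
    + (a k / 2 * enorm (xpart w - x k) ^+ 2
     + b k / 2 * enorm (ypart w - y k) ^+ 2
     + gamma / 2 * enorm (zpart w - z k) ^+ 2).
  move=> Ww; have [xmin ymin zmin] := run k.
  have [dx Lipx] := F_x (y k) (z k); have [dy Lipy] := F_y (x k.+1) (z k).
  have := block_step_le dx Lipx dy Lipy (Lxa k) (Lyb k) cg xmin ymin zmin Ww.
  rewrite /H /model_gap -/(u k) -/(u k.+1) -/(D k); lra.
have Huk k : H k (u k) = 0.
  by rewrite /H /model_gap /u !part_triple !subrr !dot0r !addr0 subrr.
(* Sufficient decrease is the sweep inequality tested at [u k], where the gap and the quadratic
   terms vanish. *)
have desc k : F (u k.+1) + c * D k ^+ 2 <= F (u k).
  have := step k _ (Wu k); rewrite Huk /u !part_triple !subrr !enorm0 expr0n /=.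
  by rewrite !mulr0 !addr0.
have D2N k : D k <= 2 * N.
  have := enormD (u k.+1) (- u k); rewrite enormN -/(D k).
  by have := uN k; have := uN k.+1; lra.
(* The normals come from the optimality conditions of the three subproblems; [n k] belongs to the
   new point [u k.+1]. *)
pose n k := triple (- gradx F (x k) (y k) (z k) - a k *: (x k.+1 - x k))
  (- grady F (x k.+1) (y k) (z k) - b k *: (y k.+1 - y k))
  (- zpart (grad F (u k.+1)) - gamma *: (z k.+1 - z k)).
have nz_near k e : 0 < e -> \forall w \near z k.+1,
    `|F (triple (x k.+1) (y k.+1) w) - F (u k.+1)
      - dot (zpart (grad F (u k.+1))) (w - z k.+1)| <= e * enorm (w - z k.+1).
  move=> e0; have /near_enormP[del del0 Hdel] :=
    differentiable_near (F_diff _ (Wu k.+1)) e0.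
  apply/near_enormP; exists del => // w wz.
  have E : triple (x k.+1) (y k.+1) w - u k.+1 = triple 0 0 (w - z k.+1).
    by rewrite /u tripleB !subrr.
  have En : enorm (triple (x k.+1) (y k.+1) w - u k.+1) <= enorm (w - z k.+1).
    by rewrite E (le_trans (enorm_triple_le _ _ _))// !enorm0 !add0r.
  have := Hdel _ (le_lt_trans En wz).
  rewrite {1}E dot_part !part_triple !dot0r !add0r.
  by move=> /le_trans; apply; rewrite ler_pM2l.
have nx k : regular_normal X (x k.+1) (xpart (n k)).
  rewrite part_triple; have [xmin _ _] := run k.
  exact: argmin_prox_normal xmin.
have ny k : regular_normal Y (y k.+1) (ypart (n k)).
  rewrite part_triple; have [_ ymin _] := run k.
  exact: argmin_prox_normal ymin.
have nz k : regular_normal Z (z k.+1) (zpart (n k)).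
  rewrite part_triple; have [_ _ zmin] := run k.
  exact: (argmin_normal (nz_near k) zmin).
have nn k : regular_normal W (u k.+1) (n k).
  by rewrite -(triple_part (n k)); exact: regular_normal_prod3.
have vD k : enorm (grad F (u k.+1) + n k)
    <= (2 * M + amax + bmax + gamma) * D k.
  apply: (block_residual_le (X := X) (Y := Y) (Z := Z) (N := 3 * N + 3)) => //.
  - exact: Wu k.
  - exact: Wu k.+1.
  - by have := D2N k; have := uN k; rewrite /D /u; move: N0; clear; lra.
have [_ _ D_small] := descent_step_small c0 (fun k => mF (u k)) D_ge0 desc.
have K0 : 0 < 2 * M + amax + bmax + gamma.
  have := a0 0%N; have := b0 0%N; have := a_le 0%N; have := b_le 0%N; lra.
have v_small e : 0 < e -> exists j, forall k, (j <= k)%N ->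
    enorm (grad F (u k.+1) + n k) < e.
  move=> e0; have [j Hj] := D_small _ (divr_gt0 e0 K0); exists j => k /Hj.
  by rewrite ltr_pdivlMr// mulrC; apply: le_lt_trans.
have A0 : 0 < amax + bmax + gamma.
  have := a0 0%N; have := b0 0%N; have := a_le 0%N; have := b_le 0%N; lra.
have [C HC] : exists C : R, forall j, \sum_(k < j) D k <= C.
  apply: (finite_length Wc F_diff gc Wu uN (fun k => mF (u k)) c0
    (_ : 0 < 5 * M) A0 desc) => [|k _ ->|ub Wub ubc].
  - by rewrite mulr_gt0.
  - rewrite -/(D k) => D1; exists (H k); split.
    + by rewrite Huk.
    + move=> w Ww wu del del0.
      apply: (@model_gap_slope _ _ _ _ F X Y Z _ _ _ _ _ (z k.+1) (D k) M N)
        => //.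
      - move=> v v' Wv Wv' vN v'N.
        by apply: HM => //; move: vN v'N D1 N0; clear; lra.
      - exact: Wu k.
      - exact: Wu k.+1.
      - exact: uN k.
    + move=> w Ww wu; apply: le_trans (step k w Ww) _; rewrite lerD2l.
      have := block_quadratic_le w (u k) (a0 k) (a_le k) (b0 k) (b_le k)
                gamma_gt0.
      by rewrite {1 2 3}/u !part_triple.
  - have crit : limiting_subdiff (Psi F X Y Z) ub 0.
      apply: (limiting_Psi_0 F_diff Wub nn _ v_small) => e j e0.
      (* Asking for an index at least [j.+1] makes it a successor, matching the shift between [n]
         and [u]. *)
      by have [[|k]//= jk kub] := ubc e j.+1 e0; exists k.
    case: Psi_KL => _ _ /(_ ub) KL; apply: KL_regular_normal => //.
    by apply: KL; exists 0.
split; first exact: finite_length_eseries D_ge0 HC.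
have /cvg_ex[us uus] := finite_length_cvg HC.
exists (xpart us), (ypart us), (zpart us); rewrite triple_part; split=> //.
have Wus : W us.
  apply: Wc => V /uus[j _ Vj]; exists (u j); split=> //.
  exact: (Vj j (leqnn j)).
have uus1 : (fun k => u k.+1) @ \oo --> us.
  apply/cvg_enormP => e e0; have [j _ Hj] := (cvg_enormP _ _).1 uus e e0.
  by exists j => // k /= jk; apply: Hj; exact: leqW.
(* The residual tends to 0 and the gradient is continuous along [W], so the normals converge; the
   blocks of their limit are limiting normals. *)
have vcvg : (fun k => n k) @ \oo --> - grad F us.
  apply/cvg_enormP => e e0; have e2 : 0 < e / 2 by rewrite divr_gt0.
  have e4 : 0 < e / 4 by rewrite divr_gt0.
  have [j Hj] := v_small _ e2.
  have /near_enormP[del del0 Hdel] := gc us Wus _ e4.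
  have H1 : \forall k \near \oo, enorm (grad F (u k.+1) + n k) < e / 2.
    by exists j => // k /Hj.
  apply: filterS2 H1 ((cvg_enormP _ _).1 uus1 _ del0) => k vk.
  move=> /Hdel/(_ (Wu k.+1)) gk.
  have -> : n k - - grad F us =
      (grad F (u k.+1) + n k) + (grad F us - grad F (u k.+1)).
    by rewrite opprK [grad F (u k.+1) + n k]addrC -addrA subrKC.
  apply: le_lt_trans (enormD _ _) _; rewrite (enormB (grad F us)).
  by move: vk gk e0; clear; lra.
exists (- grad F us); last by rewrite subrr.
case: (Wus) => Xus Yus Zus; split.
- apply: (limiting_indic Xus nx); apply/cvg_enormP => e e0.
    have := (cvg_enormP _ _).1 uus1 _ e0; apply: filterS => k.
    apply: le_lt_trans.
    by have := enorm_xpart (u k.+1 - us); rewrite xpartB part_triple.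
  have := (cvg_enormP _ _).1 vcvg _ e0; apply: filterS => k; apply: le_lt_trans.
  by have := enorm_xpart (n k - (- grad F us)); rewrite xpartB.
- apply: (limiting_indic Yus ny); apply/cvg_enormP => e e0.
    have := (cvg_enormP _ _).1 uus1 _ e0; apply: filterS => k.
    apply: le_lt_trans.
    by have := enorm_ypart (u k.+1 - us); rewrite ypartB part_triple.
  have := (cvg_enormP _ _).1 vcvg _ e0; apply: filterS => k; apply: le_lt_trans.
  by have := enorm_ypart (n k - (- grad F us)); rewrite ypartB.
- apply: (limiting_indic Zus nz); apply/cvg_enormP => e e0.
    have := (cvg_enormP _ _).1 uus1 _ e0; apply: filterS => k.
    apply: le_lt_trans.
    by have := enorm_zpart (u k.+1 - us); rewrite zpartB part_triple.
  have := (cvg_enormP _ _).1 vcvg _ e0; apply: filterS => k; apply: le_lt_trans.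
  by have := enorm_zpart (n k - (- grad F us)); rewrite zpartB.
Qed.
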